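(* There exists an arrangement of hyperplanes over $\mathbb C$ which is free, but which is neither inductively free nor rigid. (That is, Yoshinaga's conjecture $\{\text{free arrangements}\}\subset\{\text{inductively free}\}\cup\{\text{rigid}\}$ is false.)
   Context: Arrangements. An arrangement $\mathcal A$ in a finite-dimensional vector space $V$ over a field $K$ is a finite set of linear hyperplanes in $V$. Its intersection lattice $L(\mathcal A)$ is the set of all intersections of elements of $\mathcal A$ (including the empty intersection $V$), ordered by reverse inclusion. Freeness. Let $S=S(V^* )\cong K[x_1,\dots,x_r]$, and let $\mathrm{Der}(S)$ be the $S$-module of $K$-derivations of $S$, which is free with basis $D_i=\partial/\partial x_i$. Choose $\alpha_H\in V^*$ with $H=\ker\alpha_H$ and put $Q(\mathcal A)=\prod_{H\in\mathcal A}\alpha_H$. The module of $\mathcal A$-derivations is $D(\mathcal A)=\{\theta\in\mathrm{Der}(S)\mid \theta(Q(\mathcal A))\in Q(\mathcal A)S\}$. The arrangement $\mathcal A$ is free if $D(\mathcal A)$ is a free $S$-module. A nonzero $\theta=\sum f_kD_k$ is homogeneous of polynomial degree $p$ if all $f_k\in S_p$. If $\mathcal A$ is free, the multiset $\exp\mathcal A$ of exponents is the multiset of polynomial degrees of a homogeneous basis of $D(\mathcal A)$. Inductive freeness. For $H_0\in\mathcal A$ put $\mathcal A'=\mathcal A\setminus\{H_0\}$ (an arrangement in $V$) and $\mathcal A''=\mathcal A^{H_0}=\{H_0\cap H\mid H\in\mathcal A,\ H\neq H_0\}$ (an arrangement in $H_0$). The class $\mathcal{IF}$ of inductively free arrangements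 is the smallest class of arrangements such that: (i) for every $\ell\ge0$ the empty arrangement in an $\ell$-dimensional space is in $\mathcal{IF}$; (ii) if there exists $H_0\in\mathcal A$ such that $\mathcal A''\in\mathcal{IF}$, $\mathcal A'\in\mathcal{IF}$ and $\exp\mathcal A''\subset\exp\mathcal A'$ (as multisets), then $\mathcal A\in\mathcal{IF}$. All arrangements in $\mathcal{IF}$ are free, so exponents are defined. Rigidity. The moduli space of an arrangement $\mathcal A$ in $\mathbb C^r$ is the set of all arrangements in $\mathbb C^r$ whose intersection lattice is isomorphic to $L(\mathcal A)$, considered up to the action of $\mathrm{GL}_r(\mathbb C)$. The arrangement $\mathcal A$ is rigid if its moduli space is zero-dimensional (finitely many classes) and all its elements are Galois conjugate, i.e. for any two arrangements $\mathcal B,\mathcal B'$ in it there is a field automorphism $\sigma$ of $\mathbb C$ such that $\sigma(\mathcal B)$ (obtained by applying $\sigma$ to the coefficients of the defining linear forms) is $\mathrm{GL}_r(\mathbb C)$-equivalent to $\mathcal B'$. *)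

(* Defs.v *)
From HB Require Import structures.
From mathcomp Require Import all_boot all_order all_algebra.
From mathcomp Require Import finmap multiset mpoly.

Set Implicit Arguments.
Unset Strict Implicit.
Unset Printing Implicit Defensive.

Import GRing.Theory.

Local Open Scope ring_scope.
Local Open Scope mset_scope.
Local Open Scope fset_scope.

Section Arrangements.
Variables (K : fieldType) (V : vectType K).
Implicit Types (H : {vspace V}) (A : {fset {vspace V}}).

Definition hyperplane H : bool := (\dim H).+1 == \dim {:V}.

Definition arrangement A : Prop := {in A, forall H, hyperplane H}.

Lemma hyperplane_form_ex H :
  exists alpha : 'Hom(V, K^o), hyperplane H ==> (lker alpha == H).
Proof.
have [/eqP hypH|_] := boolP (hyperplane H); last by exists 0.
have dimC : \dim (H^C)%VS = 1%N by rewrite dimv_compl -hypH subSnn.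
pose u := vpick (H^C)%VS.
have u_neq0 : u != 0 by rewrite vpick0 -dimv_eq0 dimC.
have uC : u \in (H^C)%VS by rewrite memv_pick.
have trivI : ((H^C) :&: H = 0)%VS by rewrite capvC capv_compl.
pose c : 'Hom(V, K^o) := linfun (coord [tuple u] ord0 : V -> K^o).
pose p := daddv_pi (H^C)%VS H.
have cu : c u = 1.
  by rewrite lfunE /= -[X in coord _ _ X]/([tuple u]`_(@ord0 0)) coord_free
    ?eqxx // seq1_free.
exists (c \o p)%VF; rewrite eq_sym eqEdim; apply/andP; split.
  apply/subvP=> v Hv; rewrite memv_ker comp_lfunE.
  suff -> : p v = 0 by rewrite linear0.
  have := daddv_pi_add (w := v) trivI; rewrite addvC addv_complf memvf.
  move=> /(_ isT); rewrite (@daddv_pi_id _ _ H) //; last by rewrite capv_compl.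
  by move/eqP; rewrite -subr_eq0 addrK => /eqP.
have := limg_ker_dim (c \o p)%VF fullv; rewrite capfv => dimE.
have : (0 < \dim (limg (c \o p)%VF))%N.
  rewrite lt0n dimv_eq0 -subv0; apply/negP=> /subvP /(_ ((c \o p)%VF u)).
  rewrite memv_img ?memvf // memv0 comp_lfunE /p daddv_pi_id // cu.
  by move=> /(_ isT); rewrite oner_eq0.
by move=> limg_gt0; rewrite -ltnS hypH -dimE -ltn_subLR ?subnn.
Qed.

(* alpha_H; an unspecified linear form when H is not a hyperplane *)
Definition hyperplane_form H : 'Hom(V, K^o) := xchoose (hyperplane_form_ex H).

Lemma lker_hyperplane_form H : hyperplane H -> lker (hyperplane_form H) = H.
Proof. by move=> hypH; apply/eqP/(implyP (xchooseP (hyperplane_form_ex H))). Qed.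

(* Coordinates: given a basis X of V, the symmetric algebra of the dual of V is
   identified with {mpoly K[n]}, 'X_i being the i-th vector of the basis dual
   to X, and a derivation \sum_k f_k D_k with the row (f_k)_k. *)
Section Coordinates.
Variables (n : nat) (X : n.-tuple V).
Local Notation S := {mpoly K[n]}.

Definition form_mpoly (alpha : 'Hom(V, K^o)) : S :=
  \sum_(i < n) (alpha X`_i : K) *: 'X_i.

Definition defining_mpoly A : S :=
  \prod_(H <- A) form_mpoly (hyperplane_form H).

Definition der_apply (theta : 'rV[S]_n) (f : S) : S :=
  \sum_(k < n) theta 0 k * f^`M(k).

Definition derivation_module A (theta : 'rV[S]_n) : Prop :=
  exists g : S, der_apply theta (defining_mpoly A) = defining_mpoly A * g.

Definition derivation_basis A m (b : 'I_m -> 'rV[S]_n) : Prop :=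
  [/\ forall j, derivation_module A (b j),
      forall theta, derivation_module A theta ->
        exists c : 'I_m -> S, theta = \sum_(j < m) c j *: b j
    & forall c : 'I_m -> S,
        \sum_(j < m) c j *: b j = 0 -> forall j, c j = 0].

Definition homogeneous_der (p : nat) (theta : 'rV[S]_n) : Prop :=
  theta <> 0 /\ forall k, theta 0 k \is p.-homog.

End Coordinates.

(* D(A) is finitely generated since S is noetherian, so asking for a finite
   basis is no restriction; freeness and exponents do not depend on X. *)
Definition free_arrangement A : Prop :=
  exists n (X : n.-tuple V), basis_of fullv X /\
  exists m (b : 'I_m -> 'rV[{mpoly K[n]}]_n), derivation_basis X A b.

(* e is the multiset of exponents of A; in particular A is free *)
Definition exponents A (e : {mset nat}) : Prop :=
  exists n (X : n.-tuple V), basis_of fullv X /\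
  exists m (b : 'I_m -> 'rV[{mpoly K[n]}]_n) (d : 'I_m -> nat),
    [/\ derivation_basis X A b, forall j, homogeneous_der (d j) (b j)
      & e = seq_mset (codom d)].

(* H0 :&: H, as a subspace of H0, is the preimage of H under H0 -> V *)
Definition restriction A (H0 : {vspace V}) : {fset {vspace (subvs_of H0)}} :=
  [fset (linfun (@vsval K V H0) @^-1: H)%VS | H in A `\ H0].

Definition intersection_lattice A : {fset {vspace V}} :=
  [fset (\bigcap_(H <- (B : {fset {vspace V}})) H)%VS | B in fpowerset A].

End Arrangements.

Inductive inductively_free (K : fieldType) :
    forall V : vectType K, {fset {vspace V}} -> Prop :=
| IF_empty (V : vectType K) : @inductively_free K V fset0
| IF_addition (V : vectType K) (A : {fset {vspace V}}) (H0 : {vspace V})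
    (e'' e' : {mset nat}) :
    arrangement A -> H0 \in A ->
    inductively_free (restriction A H0) ->
    inductively_free (A `\ H0) ->
    exponents (restriction A H0) e'' -> exponents (A `\ H0) e' ->
    (e'' `<=` e')%mset ->
    inductively_free A.

(* The reverse inclusion orders of both lattices, hence plain inclusions too,
   correspond under phi; injectivity of phi on L(A) follows. *)
Definition lattice_isomorphic (K : fieldType) (V W : vectType K)
    (A : {fset {vspace V}}) (B : {fset {vspace W}}) : Prop :=
  exists phi : {vspace V} -> {vspace W},
    [fset phi X | X in intersection_lattice A] = intersection_lattice B /\
    {in intersection_lattice A &, forall X Y,
      (phi Y <= phi X)%VS = (Y <= X)%VS}.

Section Rigidity.
Variables (K : fieldType) (r : nat).
Local Notation V := 'rV[K]_r.
Implicit Types (A B C : {fset {vspace V}}).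

Definition GL_equivalent A B : Prop :=
  exists2 g : 'M[K]_r, g \in unitmx &
    B = [fset (linfun (mulmxr g : V -> V) @: H)%VS | H in A].

Definition form_coefs (alpha : 'Hom(V, K^o)) : 'cV[K]_r :=
  \col_i (alpha (delta_mx 0 i) : K).

Definition conj_hyperplane (sigma : {rmorphism K -> K}) (H : {vspace V}) :
    {vspace V} :=
  lker (linfun (mulmxr (map_mx sigma (form_coefs (hyperplane_form H)))
                : V -> 'rV[K]_1)).

Definition conj_arrangement (sigma : {rmorphism K -> K}) A :
    {fset {vspace V}} :=
  [fset conj_hyperplane sigma H | H in A].

(* the arrangements representing the points of the moduli space of A *)
Definition in_moduli A B : Prop := arrangement B /\ lattice_isomorphic A B.

Definition finite_moduli A : Prop :=
  exists s : seq {fset {vspace V}},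
    forall B, in_moduli A B -> exists2 C, C \in s & GL_equivalent C B.

Definition galois_conjugate B C : Prop :=
  exists2 sigma : {rmorphism K -> K}, bijective sigma &
    GL_equivalent (conj_arrangement sigma B) C.

Definition rigid A : Prop :=
  finite_moduli A /\
  forall B C, in_moduli A B -> in_moduli A C -> galois_conjugate B C.

End Rigidity.

(* Main.v *)
From HB Require Import structures.
Require Import Defs.
From mathcomp Require Import all_boot all_order all_algebra.
From mathcomp Require Import finmap reals complex.
From mathcomp Require Import mpoly ring.

Set Implicit Arguments.
Unset Strict Implicit.
Unset Printing Implicit Defensive.

Import Order.TTheory GRing.Theory Num.Theory.

Local Open Scope fset_scope.
Local Open Scope ring_scope.

(** The arrangement is a product: the failure of inductive freeness comes from
    one factor, the failure of rigidity from the other.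

    The first factor is the dual Hesse arrangement of the nine planes
    x = c y, y = c z, z = c x, with c a cube root of unity, in C^3.  It is free
    with exponents 1, 4, 4, but no deletion of it is free.  The second factor
    is the pencil of the four lines p = 0, q = 0, p = q, p + t q = 0 in C^2,
    which is free, and whose lattice is the same for all t outside {0, -1}
    whereas its cross-ratio varies with t.  The product in C^5, at t = 1, is the
    example.

    Freeness.  Linear forms are prime, so theta lies in D(A) iff each alpha_H
    divides theta(alpha_H) ([derivation_moduleP]).  For the dual Hesse factor
    the three derivations with values x_i, x_i^4 and (x_j x_k)^2 at x_i have
    determinant the defining polynomial up to sign, and for theta in D(A) the
    numerators in Cramer's rule are divisible by that determinant, so theta is
    a combination of them ([hesse_generation], [hesse_independent]).  For the
    pencil a basis is written down ([free_product]).

    No inductive freeness.  An inductive construction of an arrangement B that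
    contains the dual Hesse factor and is contained in the product ends by
    adding some H0.  If H0 belongs to the pencil, B minus H0 is a smaller
    arrangement of the same kind.  If H0 is x = c y, then D(B minus H0) is not
    a free module ([deletion_not_free]).  Write E, T, U for the three
    derivations above.  The derivation F defined by
    (x - c y) F = y T + c z U - (y^4 + y z^3) E belongs to D(B minus H0), so
    over a basis b_j the coordinates of E, T, U, F satisfy the same relation,
    and restricting it to a line in x - c y = z = 0 shows that the coordinates
    of T vanish at the origin.  On the other hand, for every eta in
    D(B minus H0), the first part of (x - c y) eta is a combination of E, T, U
    whose coefficient at T vanishes at the origin ([deletion_coef0]).
    Comparing the coefficients of T in (x - c y) T expresses the linear form
    x - c y as a sum of products of two polynomials without constant term,
    which is absurd.

    No rigidity.  The products for t = 1 and t = 2 have isomorphic lattices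
    ([product_lattice]).  The pencil for t = 1 is fixed by every field
    automorphism and is harmonic: its forms are f, g, f - g, f + g.  A linear
    equivalence would produce four hyperplanes of the product for t = 2 with
    forms proportional to f', g', f' - g', f' + g'; there are none
    ([no_harmonic_quadruple]), since only three planes of the dual Hesse
    arrangement pass through a common line and the cross-ratio of the pencil
    for t = 2 is not harmonic. *)

(** * Linear forms and divisibility *)

Definition divides (S : comNzRingType) (a b : S) := exists g, b = a * g.

Section Divides.
Variable S : comNzRingType.
Implicit Types a b c : S.

Lemma divides0 a : divides a 0.
Proof. by exists 0; rewrite mulr0. Qed.

Lemma divides_mulr a b c : divides a b -> divides a (b * c).
Proof. by case=> g ->; exists (g * c); rewrite mulrA. Qed.

Lemma divides_mull a b c : divides a b -> divides a (c * b).
Proof. by rewrite mulrC; apply: divides_mulr. Qed.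

Lemma divides_add a b c : divides a b -> divides a c -> divides a (b + c).
Proof. by case=> g -> [h ->]; exists (g + h); rewrite mulrDr. Qed.

Lemma divides_sub a b c : divides a b -> divides a c -> divides a (b - c).
Proof. by case=> g -> [h ->]; exists (g - h); rewrite mulrBr. Qed.

End Divides.

Section LinearForms.
Variables (K : fieldType) (V : vectType K) (n : nat) (X : n.-tuple V).
Hypothesis basisX : basis_of fullv X.
Local Notation S := {mpoly K[n]}.
Local Notation L := (form_mpoly X).
Implicit Types (a b : 'Hom(V, K^o)) (H : {vspace V}).

Lemma form_mpolyD a b : L (a + b) = L a + L b.
Proof.
rewrite /form_mpoly -big_split; apply: eq_bigr => i _.
by rewrite add_lfunE /= scalerDl.
Qed.

Lemma form_mpolyZ k a : L (k *: a) = k *: L a.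
Proof.
rewrite /form_mpoly scaler_sumr; apply: eq_bigr => i _.
by rewrite scale_lfunE /= scalerA.
Qed.

Lemma mmap_form (S' : comNzRingType) (f : {rmorphism K -> S'}) h a :
  mmap f h (L a) = \sum_(i < n) f (a X`_i) * h i.
Proof.
rewrite rmorph_sum /=; apply: eq_bigr => i _.
by rewrite mmapZ mmapX mmap1U.
Qed.

Lemma hom_coord a v : a v = \sum_(i < n) coord X i v *: a X`_i.
Proof.
rewrite {1}(coord_basis basisX (memvf v)) linear_sum.
by apply: eq_bigr => i _; rewrite linearZ.
Qed.

(** The polynomial t |-> f (t v): orders of vanishing at the origin are tested
    on lines through the origin. *)
Definition line_restr (v : V) : S -> {poly K} :=
  mmap (@polyC K) (fun i => coord X i v *: 'X).
HB.instance Definition _ v := GRing.RMorphism.copy (line_restr v)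
  (mmap (@polyC K) (fun i => coord X i v *: 'X)).

Lemma line_restr_form v a : line_restr v (L a) = (a v : K) *: 'X.
Proof.
rewrite /line_restr mmap_form hom_coord scaler_suml; apply: eq_bigr => i _.
by rewrite mul_polyC scalerA mulrC.
Qed.

Lemma line_restrC v c : line_restr v c%:MP = c%:P.
Proof. by rewrite /line_restr mmapC. Qed.

(** Both sides are the constant coefficient of [f]. *)
Lemma line_restr0 u v f : (line_restr u f)`_0 = (line_restr v f)`_0.
Proof.
suff E v' : (line_restr v' f)`_0 = f@_0%MM by rewrite !E.
rewrite -horner_coef0; elim/mpolyind: f => [|c m p _ _ IH].
  by rewrite rmorph0 horner0 mcoeff0.
rewrite rmorphD hornerD mcoeffD IH; congr (_ + _).
rewrite -mul_mpolyC rmorphM /= line_restrC /line_restr mmapX mcoeffCM mcoeffX.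
rewrite hornerM hornerC; congr (_ * _).
rewrite /mmap1 horner_prod; have [->|m_neq0] := eqVneq m 0%MM.
  by rewrite big1 // => i _; rewrite mnm0E expr0 hornerC.
have [i mi] : exists i, m i != 0%N.
  apply/existsP; apply: contraNT m_neq0; rewrite negb_exists => /forallP m0.
  by apply/eqP/mnmP => i; rewrite mnm0E; apply/eqP/negbNE/m0.
by rewrite (bigD1 i) //= horner_exp hornerZ hornerX mulr0 expr0n (negPf mi) mul0r.
Qed.

Lemma hom_neq0P a : a != 0 -> exists u, a u = 1.
Proof.
move=> a0; case: (pickP (fun i : 'I_n => (a X`_i : K) != 0)) => [i ai|a_0].
  exists ((a X`_i : K)^-1 *: X`_i).
  by rewrite linearZ /= -[LHS]/((a X`_i : K)^-1 * (a X`_i : K)) mulVf.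
case/negP: a0; apply/eqP/lfunP => v; rewrite hom_coord zero_lfunE big1 // => i _.
move/negbFE/eqP: (a_0 i) => ai.
by rewrite -[LHS]/(coord X i v * (a X`_i : K)) ai mulr0.
Qed.

Lemma form_mpoly_neq0 a : a != 0 -> L a != 0.
Proof.
case/hom_neq0P=> u au; apply/eqP=> /(congr1 (line_restr u)).
rewrite line_restr_form au scale1r rmorph0.
by apply/eqP; rewrite polyX_eq0.
Qed.

(** Composition with the projection onto the kernel of [a] along [u], when
    [a u = 1].  It kills [L a] and is the identity modulo [L a], hence its kernel
    is the ideal generated by [L a]. *)
Definition proj_restr a (u : V) : S -> S :=
  mmap (@mpolyC n K) (fun i => 'X_i - coord X i u *: L a).
HB.instance Definition _ a u := GRing.RMorphism.copy (proj_restr a u)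
  (mmap (@mpolyC n K) (fun i => 'X_i - coord X i u *: L a)).

Lemma proj_restr_form a u b : proj_restr a u (L b) = L b - (b u : K) *: L a.
Proof.
rewrite /proj_restr mmap_form (hom_coord b) scaler_suml /form_mpoly -sumrB.
apply: eq_bigr => i _; rewrite mulrBr mul_mpolyC.
by rewrite mul_mpolyC scalerA mulrC.
Qed.

Lemma divides_proj_restr a u f : divides (L a) (f - proj_restr a u f).
Proof.
have subM g h : divides (L a) (g - proj_restr a u g) ->
    divides (L a) (h - proj_restr a u h) ->
    divides (L a) (g * h - proj_restr a u (g * h)).
  move=> dg dh; rewrite rmorphM /=.
  set g' := proj_restr a u g in dg *; set h' := proj_restr a u h in dh *.
  have -> : g * h - g' * h' = (g - g') * h + g' * (h - h') by ring.
  by apply: divides_add; [apply: divides_mulr | apply: divides_mull].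
have subC c : divides (L a) (c%:MP - proj_restr a u c%:MP).
  by rewrite /proj_restr mmapC subrr; apply: divides0.
elim/mpolyind: f => [|c m p _ _ IH]; first by rewrite rmorph0 subr0; apply: divides0.
rewrite rmorphD opprD addrACA; apply: divides_add => //.
rewrite -mul_mpolyC; apply: (subM) => //.
rewrite mpolyXE_id; apply: (big_ind (fun q => divides (L a) (q - proj_restr a u q))).
- by rewrite rmorph1 subrr; apply: divides0.
- exact: subM.
move=> i _; elim: (m i) => [|k IHk].
  by rewrite expr0 rmorph1 subrr; apply: divides0.
rewrite exprS; apply: subM => //.
rewrite /proj_restr mmapX mmap1U opprB addrC subrK -mul_mpolyC.
by exists (coord X i u)%:MP; rewrite mulrC.
Qed.

Lemma divides_proj_restrP a u f : a u = 1 ->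
  divides (L a) f <-> proj_restr a u f = 0.
Proof.
move=> au; split=> [[g ->]|f0].
  by rewrite rmorphM /= proj_restr_form au scale1r subrr mul0r.
by have := divides_proj_restr a u f; rewrite f0 subr0.
Qed.

(** Divisibility by a linear form can be tested in the image of any
    substitution that kills the form, where an identity modulo the form becomes
    an identity between polynomials. *)
Lemma divides_form_rmorph a f : a != 0 ->
  (forall s : {rmorphism S -> S}, (forall c, s c%:MP = c%:MP) ->
     s (L a) = 0 -> s f = 0) ->
  divides (L a) f.
Proof.
move=> /hom_neq0P[u au] van; apply/(divides_proj_restrP f au).
apply: van => [c|]; first by rewrite [LHS]mmapC.
by rewrite [LHS]proj_restr_form au scale1r subrr.
Qed.

(** The ideal generated by a linear form is the kernel of a morphism to a
    domain. *)
Lemma form_mpoly_prime a f g : a != 0 ->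
  divides (L a) (f * g) -> divides (L a) f \/ divides (L a) g.
Proof.
case/hom_neq0P=> u au; rewrite !(divides_proj_restrP _ au) rmorphM /=.
by move=> /eqP; rewrite mulf_eq0 => /orP[] /eqP; [left|right].
Qed.

(** Evaluate at the points of [lker a]. *)
Lemma divides_form_lker a b : divides (L a) (L b) -> (lker a <= lker b)%VS.
Proof.
case=> g Lb; apply/subvP => v; rewrite !memv_ker => /eqP av.
have := congr1 (line_restr v) Lb.
rewrite rmorphM /= !line_restr_form av scale0r mul0r => /eqP.
by rewrite scaler_eq0 polyX_eq0 orbF.
Qed.

Lemma lker_sub_hom a b : (lker a <= lker b)%VS -> exists k : K, b = k *: a.
Proof.
move=> /subvP sub_ab; have [a0|/hom_neq0P[u au]] := eqVneq a 0.
  exists 0; rewrite scale0r; apply/lfunP => v; rewrite zero_lfunE.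
  by apply/eqP; rewrite -memv_ker sub_ab // a0 memv_ker zero_lfunE.
exists (b u : K); apply/lfunP => v; rewrite scale_lfunE /=.
have /sub_ab : v - (a v : K) *: u \in lker a.
  rewrite memv_ker linearB linearZ /= au -[X in _ - X]/((a v : K) * 1).
  by rewrite mulr1 subrr.
rewrite memv_ker linearB linearZ /= subr_eq0 => /eqP ->.
by rewrite -[LHS]/((a v : K) * (b u : K)) mulrC.
Qed.

(** Each new form is prime to the previous ones, hence divides the cofactor of
    their product. *)
Lemma coprime_forms_prod (I : eqType) (s : seq I) (a : I -> 'Hom(V, K^o)) f :
  uniq s -> {in s, forall i, a i != 0} ->
  {in s &, forall i j, i != j -> ~ divides (L (a i)) (L (a j))} ->
  {in s, forall i, divides (L (a i)) f} ->
  divides (\prod_(i <- s) L (a i)) f.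
Proof.
elim: s f => [|i s IH] f; first by exists f; rewrite big_nil mul1r.
rewrite cons_uniq => /andP[i_s us] nz cop dvd.
have [g fE] := dvd i (mem_head _ _).
have [| | |h gE] := IH g us.
- by move=> j js; apply: nz; rewrite inE js orbT.
- by move=> j k js ks; apply: cop; rewrite inE ?js ?ks orbT.
- move=> j js; have js' : j \in i :: s by rewrite inE js orbT.
  have := dvd j js'; rewrite fE => /(form_mpoly_prime (nz j js')) [] // d.
  by case: (cop j i js' (mem_head _ _) _ d); apply: contraNneq i_s => <-.
by exists h; rewrite big_cons fE gE mulrA.
Qed.

(** * Logarithmic derivations *)

Implicit Type theta : 'rV[S]_n.

Lemma der_applyM theta f g :
  der_apply theta (f * g) = der_apply theta f * g + f * der_apply theta g.
Proof.
rewrite /der_apply mulr_suml mulr_sumr -big_split; apply: eq_bigr => k _ /=.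
by rewrite mderivM; ring.
Qed.

Lemma der_apply1 theta : der_apply theta 1 = 0.
Proof.
by rewrite /der_apply big1 // => k _; rewrite -mpolyC1 mderivC mulr0.
Qed.

Lemma der_apply_form theta a :
  der_apply theta (L a) = \sum_(k < n) (a X`_k : K) *: theta 0 k.
Proof.
apply: eq_bigr => k _; rewrite /form_mpoly.
have -> : (\sum_(i < n) (a X`_i : K) *: 'X_i)^`M(k) =
    \sum_(i < n) (a X`_i : K) *: ('X_i : S)^`M(k).
  by rewrite linear_sum; apply: eq_bigr => i _; rewrite linearZ.
rewrite (bigD1 k) //= big1 => [|i ik]; last first.
  by rewrite mderivX mnm1E (negPf ik) scale0r scaler0.
by rewrite mderivX mnm1E eqxx scale1r -{1}[U_(k)%MM]add0m addmK mpolyX0 addr0 -scalerAr mulr1.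
Qed.

Lemma der_applyZ theta k a :
  der_apply theta (L (k *: a)) = k *: der_apply theta (L a).
Proof.
rewrite !der_apply_form scaler_sumr; apply: eq_bigr => i _.
by rewrite scale_lfunE /= scalerA.
Qed.

Lemma der_apply_lin m (c : 'I_m -> S) (b : 'I_m -> 'rV[S]_n) f :
  der_apply (\sum_(j < m) c j *: b j) f = \sum_(j < m) c j * der_apply (b j) f.
Proof.
rewrite /der_apply; under [RHS]eq_bigr do rewrite mulr_sumr.
rewrite exchange_big /=; apply: eq_bigr => k _.
rewrite summxE mulr_suml; apply: eq_bigr => j _.
by rewrite mxE mulrA.
Qed.

Lemma hyperplane_form_neq0 H : hyperplane H -> hyperplane_form H != 0.
Proof.
move=> hH; apply/eqP=> f0.
suff HE : H = fullv by move: hH; rewrite /hyperplane HE eqn_leq ltnn.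
apply/eqP; rewrite eqEsubv subvf -(lker_hyperplane_form hH) f0.
by apply/subvP => v _; rewrite memv_ker zero_lfunE.
Qed.

Lemma hyperplane_form_coprime H H' : hyperplane H -> hyperplane H' -> H != H' ->
  ~ divides (L (hyperplane_form H)) (L (hyperplane_form H')).
Proof.
move=> hH hH' neqH /divides_form_lker.
rewrite !lker_hyperplane_form // => sub; case/negP: neqH.
rewrite eqEdim sub; move/eqP: hH => e1; move/eqP: hH' => e2.
by move: e1; rewrite -e2 /= => -[->].
Qed.

(** By the Leibniz rule, modulo [alpha_H] the derivative of the product of all
    forms is [theta (alpha_H)] times the other forms, and those are prime to
    [alpha_H]. *)
Lemma derivation_moduleP (A : {fset {vspace V}}) theta : arrangement A ->
  derivation_module X A theta <->
  {in A, forall H, divides (L (hyperplane_form H))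
                           (der_apply theta (L (hyperplane_form H)))}.
Proof.
move=> arrA; split=> [[g Dg] H HA|dvd]; last first.
  suff P (s : seq {vspace V}) : {subset s <= A} ->
      divides (\prod_(H <- s) L (hyperplane_form H))
      (der_apply theta (\prod_(H <- s) L (hyperplane_form H))).
    by have [|g Dg] := P (enum_fset A); last by exists g.
  elim: s => [|H s IH] sA; first by rewrite big_nil der_apply1; apply: divides0.
  have [|g gE] := IH; first by move=> x xs; rewrite sA // inE xs orbT.
  have [h hE] := dvd H (sA _ (mem_head _ _)).
  rewrite big_cons der_applyM hE gE; set P := \prod_(_ <- s) _.
  by exists (h + g); ring.
set a := hyperplane_form H; pose P := \prod_(H' <- rem H A) L (hyperplane_form H').
have QE : defining_mpoly X A = L a * P.
  by rewrite /defining_mpoly (perm_big _ (perm_to_rem HA)) big_cons.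
have a0 : a != 0 by apply/hyperplane_form_neq0/arrA.
have: divides (L a) (der_apply theta (L a) * P).
  exists (P * g - der_apply theta P); rewrite mulrBr mulrA -QE -Dg QE der_applyM.
  by rewrite addrK.
case/(form_mpoly_prime a0) => // /[dup] dP; rewrite /P.
suff Q (s : seq {vspace V}) : {subset s <= A} -> H \notin s ->
    ~ divides (L a) (\prod_(H <- s) L (hyperplane_form H)).
  move/Q; case; last by rewrite mem_rem_uniqF.
  by move=> x; apply: mem_rem.
elim: s => [|H' s IH] sA.
  rewrite big_nil => _ [h /esym Lh].
  have := congr1 (line_restr 0) Lh.
  rewrite rmorphM /= line_restr_form linear0 scale0r mul0r rmorph1 => /eqP.
  by rewrite eq_sym oner_eq0.
rewrite inE negb_or big_cons => /andP[HH' Hs] /(form_mpoly_prime a0) [].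
  by apply: hyperplane_form_coprime => //; apply: arrA => //; apply/sA/mem_head.
by apply: IH => // x xs; apply: sA; rewrite inE xs orbT.
Qed.

End LinearForms.

(** * Hyperplanes of K^r given by coefficient columns *)

Section Columns.
Variables (K : fieldType) (r : nat).
Local Notation V := 'rV[K]_r.
Implicit Types (a b : 'cV[K]_r) (v : V).

Definition col_eval a v : K^o := (v *m a) 0 0.

Fact col_eval_is_linear a : linear (col_eval a).
Proof. by move=> k u v; rewrite /col_eval mulmxDl -scalemxAl !mxE. Qed.
HB.instance Definition _ a := GRing.isLinear.Build K V K^o _ (col_eval a)
  (col_eval_is_linear a).

Definition col_form a : 'Hom(V, K^o) := linfun (col_eval a).

Definition hyp a : {vspace V} := lker (col_form a).

Lemma col_formE a v : col_form a v = (v *m a) 0 0.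
Proof. exact: lfunE. Qed.

Lemma mem_hyp a v : (v \in hyp a) = ((v *m a) 0 0 == 0).
Proof. by rewrite memv_ker col_formE. Qed.

Lemma col_form_delta a i : col_form a (delta_mx 0 i) = a i 0.
Proof. by rewrite col_formE -rowE mxE. Qed.

Lemma col_formZ k a : col_form (k *: a) = k *: col_form a.
Proof.
by apply/lfunP => v; rewrite scale_lfunE !col_formE -scalemxAr mxE.
Qed.

Lemma col_form_inj : injective col_form.
Proof.
move=> a b ab; apply/matrixP => i j; rewrite ord1 -!col_form_delta.
by rewrite ab.
Qed.

Lemma col_form_neq0 a : a != 0 -> col_form a != 0.
Proof.
apply: contra_neq => a0; apply/matrixP => i j.
by rewrite ord1 -col_form_delta a0 zero_lfunE mxE.
Qed.

Lemma lker_mulmxr a : lker (linfun (mulmxr a : V -> 'rV[K]_1)) = hyp a.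
Proof.
apply/vspaceP => v; rewrite [RHS]mem_hyp memv_ker lfunE /=.
apply/eqP/eqP => [->|va]; first by rewrite mxE.
by apply/rowP => i; rewrite ord1 va mxE.
Qed.

Lemma hypZ k a : k != 0 -> hyp (k *: a) = hyp a.
Proof.
move=> k0; apply/vspaceP => v; rewrite !mem_hyp -scalemxAr mxE.
by rewrite mulf_eq0 (negPf k0).
Qed.

Lemma hyp_proportional a b : a != 0 -> hyp a = hyp b ->
  exists2 k, k != 0 & a = k *: b.
Proof.
move=> a0 ab; have [|k kE] := lker_sub_hom (vbasisP fullv) (a := col_form b)
   (b := col_form a); first by rewrite -/(hyp a) ab.
have aE : a = k *: b by apply: col_form_inj; rewrite kE col_formZ.
by exists k => //; apply: contra_neq a0 => k0; rewrite aE k0 scale0r.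
Qed.

Lemma hyperplane_hyp a : a != 0 -> hyperplane (hyp a).
Proof.
move=> /col_form_neq0 /(hom_neq0P (vbasisP fullv)) [u au].
rewrite /hyperplane -(limg_ker_dim (col_form a) fullv) capfv addnC.
suff -> : \dim (limg (col_form a)) = 1%N by [].
apply/eqP; rewrite eqn_leq; apply/andP; split.
  by rewrite (leq_trans (dimvS (subvf _))) // dimvf.
rewrite lt0n dimv_eq0; apply/eqP => lim0.
have := memv_img (col_form a) (memvf u); rewrite lim0 memv0 au.
by rewrite -[_ == _]/((1 : K) == 0) oner_eq0.
Qed.

Lemma hyperplane_form_hyp a : a != 0 ->
  exists2 k, k != 0 & hyperplane_form (hyp a) = col_form (k *: a).
Proof.
move=> a0; have hH := hyperplane_hyp a0.
have [|k kE] := lker_sub_hom (vbasisP fullv) (a := col_form a)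
   (b := hyperplane_form (hyp a)); first by rewrite lker_hyperplane_form.
exists k; last by rewrite col_formZ.
apply: contraNneq (hyperplane_form_neq0 hH) => k0.
by rewrite kE k0 scale0r.
Qed.

Section Values.
Variables (n : nat) (X : n.-tuple V).
Hypothesis basisX : basis_of fullv X.
Local Notation S := {mpoly K[n]}.
Local Notation L := (form_mpoly X).
Implicit Type theta : 'rV[S]_n.

(** The coordinate functions on K^r as polynomials in the coordinates dual to
    the basis [X], locked so that they behave as indeterminates.  Derivations are
    described by their values on these forms, so that the computations are the
    same for every basis [X]. *)
Fact xi_key : unit. Proof. exact: tt. Qed.
Definition xi (i : 'I_r) : S :=
  locked_with xi_key (L (col_form (delta_mx i 0))).

Lemma xiE i : xi i = L (col_form (delta_mx i 0)).
Proof. by rewrite /xi unlock. Qed.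

Lemma col_form_sum a : col_form a = \sum_i a i 0 *: col_form (delta_mx i 0).
Proof.
apply/lfunP => v; rewrite sum_lfunE col_formE mxE; apply: eq_bigr => i _.
rewrite scale_lfunE col_formE -colE mxE.
by rewrite -[RHS]/(a i 0 * v 0 i) mulrC.
Qed.

Lemma form_mpoly_sum (J : finType) (k : J -> K) (a : J -> 'Hom(V, K^o)) :
  L (\sum_j k j *: a j) = \sum_j k j *: L (a j).
Proof.
elim/big_rec2: _ => [|j f g _ <-]; last by rewrite form_mpolyD form_mpolyZ.
by rewrite -[X in L X](scale0r 0) form_mpolyZ scale0r.
Qed.

Lemma form_col a : L (col_form a) = \sum_i a i 0 *: xi i.
Proof. rewrite col_form_sum form_mpoly_sum.
by apply: eq_bigr => i _; rewrite xiE. Qed.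

Definition coord_val theta i : S := der_apply theta (xi i).

Lemma coord_val_lin m (c : 'I_m -> S) (b : 'I_m -> 'rV[S]_n) i :
  coord_val (\sum_(j < m) c j *: b j) i = \sum_(j < m) c j * coord_val (b j) i.
Proof. exact: der_apply_lin. Qed.

Lemma der_apply_col theta a :
  der_apply theta (L (col_form a)) = \sum_i a i 0 *: coord_val theta i.
Proof.
rewrite form_col /coord_val /der_apply.
under [RHS]eq_bigr do rewrite scaler_sumr.
rewrite exchange_big; apply: eq_bigr => k _ /=.
rewrite linear_sum mulr_sumr; apply: eq_bigr => i _.
by rewrite linearZ /= scalerAr.
Qed.

(** The derivation with prescribed values on the coordinate functions. *)
Definition vfield (P : 'I_r -> S) : 'rV[S]_n :=
  \row_k \sum_i coord X k (delta_mx 0 i) *: P i.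

Lemma coord_val_vfield P i : coord_val (vfield P) i = P i.
Proof.
rewrite /coord_val xiE der_apply_form.
under eq_bigr do rewrite mxE scaler_sumr.
rewrite exchange_big (bigD1 i) //= [X in _ + X]big1 => [|j ji]; rewrite ?addr0.
  under eq_bigr do rewrite scalerA mulrC.
  rewrite -scaler_suml -[X in X *: _]/(\sum_k coord X k (delta_mx 0 i) *:
    col_form (delta_mx i 0) X`_k) -hom_coord // col_form_delta mxE !eqxx.
  by rewrite scale1r.
under eq_bigr do rewrite scalerA mulrC.
rewrite -scaler_suml -[X in X *: _]/(\sum_k coord X k (delta_mx 0 j) *:
  col_form (delta_mx i 0) X`_k) -hom_coord // col_form_delta mxE (negPf ji).
by rewrite scale0r.
Qed.

Lemma coord_val_inj theta theta' :
  coord_val theta =1 coord_val theta' -> theta = theta'.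
Proof.
move=> eqv; suff E t : t = vfield (coord_val t).
  rewrite (E theta) (E theta'); apply/rowP => k; rewrite !mxE.
  by apply: eq_bigr => i _; rewrite eqv.
apply/rowP => k; rewrite mxE.
under eq_bigr do rewrite /coord_val xiE der_apply_form scaler_sumr.
have coordX (l : 'I_n) : \sum_i coord X k (delta_mx 0 i) * X`_l 0 i = (l == k)%:R.
  rewrite -(coord_free l k (basis_free basisX)) {2}(row_sum_delta X`_l) linear_sum.
  by apply: eq_bigr => i _; rewrite linearZ /= mulrC.
rewrite exchange_big (bigD1 k) //= [X in _ + X]big1 => [|l lk]; rewrite ?addr0.
  under eq_bigr do rewrite scalerA col_formE -colE mxE.
  by rewrite -scaler_suml coordX eqxx scale1r.
under eq_bigr do rewrite scalerA col_formE -colE mxE.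
by rewrite -scaler_suml coordX (negPf lk) scale0r.
Qed.

End Values.
End Columns.

(** * Cramer's rule for the dual Hesse arrangement *)

Lemma prod3 (T : comNzRingType) (f : 'I_3 -> T) :
  \prod_i f i = f ord0 * f (ordS ord0) * f (ordS (ordS ord0)).
Proof.
rewrite !big_ord_recl big_ord0 mulr1 mulrA.
by congr (_ * f _ * f _); apply/val_inj.
Qed.

Section HesseAlgebra.
Variable T : comNzRingType.
Implicit Types c x y z e f g : T.

(** The defining polynomial of the dual Hesse arrangement. *)
Definition hesse_disc x y z :=
  (x ^+ 3 - y ^+ 3) * (y ^+ 3 - z ^+ 3) * (z ^+ 3 - x ^+ 3).

(** Up to sign, [cramer0], [cramer1], [cramer2] are the determinants obtained
    from the matrix with rows (x, y, z), (x^4, y^4, z^4),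
    ((y z)^2, (z x)^2, (x y)^2) on replacing one row by (e, f, g). *)
Definition cramer0 x y z e f g :=
  e * x ^+ 2 * (y ^+ 6 - z ^+ 6) + f * y ^+ 2 * (z ^+ 6 - x ^+ 6)
  + g * z ^+ 2 * (x ^+ 6 - y ^+ 6).

Definition cramer1 x y z e f g :=
  (y * g - z * f) * (y * z) ^+ 2 + (z * e - x * g) * (z * x) ^+ 2
  + (x * f - y * e) * (x * y) ^+ 2.

Definition cramer2 x y z e f g :=
  (z * f - y * g) * x ^+ 4 + (x * g - z * e) * y ^+ 4 + (y * e - x * f) * z ^+ 4.

Lemma hesse_disc_rot x y z : hesse_disc x y z = hesse_disc y z x.
Proof. by rewrite /hesse_disc; ring. Qed.

Lemma cramer_rot x y z e f g :
  [/\ cramer0 x y z e f g = cramer0 y z x f g e,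
      cramer1 x y z e f g = cramer1 y z x f g e
    & cramer2 x y z e f g = cramer2 y z x f g e].
Proof. by rewrite /cramer0 /cramer1 /cramer2; split; ring. Qed.

Lemma cramer_rule x y z e f g :
  hesse_disc x y z * e = cramer0 x y z e f g * x + cramer1 x y z e f g * x ^+ 4
                         + cramer2 x y z e f g * (y * z) ^+ 2.
Proof. by rewrite /hesse_disc /cramer0 /cramer1 /cramer2; ring. Qed.

(** The numerators vanish on the plane x = c y if (e, f, g) is tangent to it.
    By [cramer_rot] this is enough for all nine planes. *)
Lemma cramer_vanish c y z f g : c ^+ 3 = 1 ->
  [/\ cramer0 (c * y) y z (c * f) f g = 0, cramer1 (c * y) y z (c * f) f g = 0
    & cramer2 (c * y) y z (c * f) f g = 0].
Proof. by move=> c3; rewrite /cramer0 /cramer1 /cramer2; split; ring: c3. Qed.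

Lemma cramer1_comb a b c x y z :
  cramer1 x y z (a * x + b * x ^+ 4 + c * (y * z) ^+ 2)
                (a * y + b * y ^+ 4 + c * (z * x) ^+ 2)
                (a * z + b * z ^+ 4 + c * (x * y) ^+ 2) = hesse_disc x y z * b.
Proof. by rewrite /cramer1 /hesse_disc; ring. Qed.

Lemma cramer2_comb a b c x y z :
  cramer2 x y z (a * x + b * x ^+ 4 + c * (y * z) ^+ 2)
                (a * y + b * y ^+ 4 + c * (z * x) ^+ 2)
                (a * z + b * z ^+ 4 + c * (x * y) ^+ 2) = hesse_disc x y z * c.
Proof. by rewrite /cramer2 /hesse_disc; ring. Qed.

Lemma cramer0_comb a b c x y z :
  cramer0 x y z (a * x + b * x ^+ 4 + c * (y * z) ^+ 2)
                (a * y + b * y ^+ 4 + c * (z * x) ^+ 2)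
                (a * z + b * z ^+ 4 + c * (x * y) ^+ 2) = hesse_disc x y z * a.
Proof. by rewrite /cramer0 /hesse_disc; ring. Qed.

Lemma cramer_independent a b c x y z :
  a * x + b * x ^+ 4 + c * (y * z) ^+ 2 = 0 ->
  a * y + b * y ^+ 4 + c * (z * x) ^+ 2 = 0 ->
  a * z + b * z ^+ 4 + c * (x * y) ^+ 2 = 0 ->
  [/\ hesse_disc x y z * a = 0, hesse_disc x y z * b = 0
    & hesse_disc x y z * c = 0].
Proof.
move=> e f g; rewrite -(cramer0_comb a b c) -(cramer1_comb a b c).
rewrite -(cramer2_comb a b c) e f g /cramer0 /cramer1 /cramer2.
by rewrite !(mul0r, mulr0, subrr, addr0).
Qed.

End HesseAlgebra.

Lemma cramer_morph (T T' : comNzRingType) (s : {rmorphism T -> T'}) x y z e f g :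
  [/\ s (cramer0 x y z e f g) = cramer0 (s x) (s y) (s z) (s e) (s f) (s g),
      s (cramer1 x y z e f g) = cramer1 (s x) (s y) (s z) (s e) (s f) (s g)
    & s (cramer2 x y z e f g) = cramer2 (s x) (s y) (s z) (s e) (s f) (s g)].
Proof.
by split; rewrite /cramer0 /cramer1 /cramer2 !(rmorphD, rmorphN, rmorphM, rmorphXn).
Qed.

(** * The product arrangements *)

Section HypValues.
Variables (K : fieldType) (r n : nat) (X : n.-tuple 'rV[K]_r).
Hypothesis basisX : basis_of fullv X.
Local Notation S := {mpoly K[n]}.
Local Notation L := (form_mpoly X).

Lemma divides_scale (k : K) (f g : S) : k != 0 ->
  divides (k *: f) (k *: g) <-> divides f g.
Proof.
move=> k0; split=> -[h E]; exists h; last by rewrite E scalerAl.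
by apply: (scalerI k0); rewrite E scalerAl.
Qed.

Lemma divides_hyp (theta : 'rV[S]_n) (a : 'cV[K]_r) : a != 0 ->
  divides (L (hyperplane_form (hyp a))) (der_apply theta (L (hyperplane_form (hyp a))))
  <-> divides (\sum_i a i 0 *: xi X i) (\sum_i a i 0 *: coord_val X theta i).
Proof.
move=> a0; have [k k0 ->] := hyperplane_form_hyp a0.
rewrite col_formZ form_mpolyZ -form_mpolyZ der_applyZ form_mpolyZ divides_scale //.
by rewrite der_apply_col form_col.
Qed.

End HypValues.

Section Product.
Variables (K : numFieldType) (w : K).
Hypothesis w_root : w ^+ 2 + w + 1 = 0.

Local Notation V := 'rV[K]_(3 + 2).
Local Notation delta i := (delta_mx i 0 : 'cV[K]_(3 + 2)).

Lemma w2E : w ^+ 2 = - w - 1.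
Proof. by apply/eqP; rewrite -subr_eq0; apply/eqP; rewrite -w_root; ring. Qed.

Lemma w3 : w ^+ 3 = 1.
Proof. by ring: w2E. Qed.

Lemma w_neq0 : w != 0.
Proof.
by apply/eqP => w0; have := w3; rewrite w0 expr0n /= => /eqP; rewrite eq_sym oner_eq0.
Qed.

Lemma w_neq1 : w != 1.
Proof.
have n3 : (3 : K) != 0 by rewrite pnatr_eq0.
by apply: contra_neq n3 => w1; have := w_root; rewrite w1 => <-; ring.
Qed.

Lemma w_inj (k l : 'I_3) : w ^+ k = w ^+ l -> k = l.
Proof.
have E2 : w ^+ 2 != 1.
  apply: contra_neq w_neq1 => w1; have := w3; rewrite exprS w1 mulr1; exact.
have E3 : w ^+ 2 != w.
  apply: contra_neq w_neq1 => w1; have := w3; rewrite exprSr w1 -expr2 w1; exact.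
have E1 := w_neq1.
case: k l => [[|[|[|//]]] ki] [[|[|[|//]]] li] /= wkl; apply/val_inj => //=;
  move: wkl E1 E2 E3; rewrite ?expr0 ?expr1 => wkl;
  first [by rewrite -wkl eqxx | by rewrite wkl eqxx].
Qed.

(** The moving point t changes the cross-ratio of the pencil but, as long as the
    four lines are distinct, not its lattice. *)
Definition pencil (t : K) : 'I_4 -> K * K :=
  tnth [tuple (1, 0); (0, 1); (1, -1); (1, t)].

Local Notation index := ('I_3 * 'I_3 + 'I_4)%type.

(** Indices [inl (i, k)] stand for the plane x_i = w^k x_(i+1), with i modulo
    3, and [inr j] for the lines of the pencil. *)
Definition normal (t : K) (i : index) : 'cV[K]_(3 + 2) :=
  match i with
  | inl (i, k) => delta (lshift 2 i) - w ^+ k *: delta (lshift 2 (ordS i))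
  | inr j => (pencil t j).1 *: delta (rshift 3 0)
             + (pencil t j).2 *: delta (rshift 3 1)
  end.

Arguments normal : simpl never.

Definition product_arr (t : K) : {fset {vspace V}} :=
  [fset hyp (normal t i) | i in {: index}].

Lemma product_arrP t H :
  reflect (exists i, H = hyp (normal t i)) (H \in product_arr t).
Proof.
apply: (iffP (imfsetP _ _ _ _)) => [[i _ ->]|[i ->]]; first by exists i.
by exists i.
Qed.

Lemma normal_hesse_l t i k l :
  normal t (inl (i, k)) (lshift 2 l) 0 =
  (l == i)%:R - w ^+ k * (l == ordS i)%:R.
Proof. by rewrite !mxE !eqxx !andbT !eq_lshift. Qed.

Lemma normal_hesse_r t i k l : normal t (inl (i, k)) (rshift 3 l) 0 = 0.
Proof. by rewrite !mxE !eqxx !andbT !eq_rlshift mulr0 subr0. Qed.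

Lemma normal_pencil_l t j l : normal t (inr j) (lshift 2 l) 0 = 0.
Proof. by rewrite !mxE !eqxx !andbT !eq_lrshift !mulr0 addr0. Qed.

Lemma normal_pencil_r t j l : normal t (inr j) (rshift 3 l) 0 =
  if l == 0 then (pencil t j).1 else (pencil t j).2.
Proof.
rewrite !mxE !eqxx !andbT !eq_rshift.
by case: l => [[|[|//]]] li /=; rewrite !(mulr1, mulr0, addr0, add0r).
Qed.

Lemma pencil_neq0 t j : (pencil t j).1 = 0 -> (pencil t j).2 = 0 -> False.
Proof.
by case: j => [[|[|[|[|//]]]] ji]; rewrite /pencil (tnth_nth (0, 0)) /= => /eqP;
  rewrite ?oner_eq0 // => _ /eqP; rewrite oner_eq0.
Qed.

Definition pencil_det t i j :=
  (pencil t i).1 * (pencil t j).2 - (pencil t i).2 * (pencil t j).1.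

Lemma pencil_det_neq0 t i j : t != 0 -> t != -1 -> i != j -> pencil_det t i j != 0.
Proof.
move=> t0; rewrite -addr_eq0 => t1; rewrite /pencil_det /pencil !(tnth_nth (0, 0)).
case: i j => [[|[|[|[|//]]]] i4] [[|[|[|[|//]]]] j4] //= _;
rewrite !(mulr0, mul0r, mulr1, mul1r, subr0, sub0r, opprK, oppr_eq0, oner_eq0) //.
by rewrite -opprD oppr_eq0 addrC.
Qed.

Lemma normal_neq0 t i : normal t i != 0.
Proof.
apply/eqP => /colP n0; case: i n0 => [[i k]|j] n0.
  have := n0 (lshift 2 i); rewrite normal_hesse_l mxE eqxx.
  have -> : (i == ordS i) = false by case: i {n0} => [[|[|[|]]]].
  by rewrite mulr0 subr0 => /eqP; rewrite oner_eq0.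
have := n0 (rshift 3 1); have := n0 (rshift 3 0).
by rewrite !normal_pencil_r !mxE; apply: pencil_neq0.
Qed.

Lemma arrangement_product t : arrangement (product_arr t).
Proof. by move=> H /product_arrP[i ->]; apply/hyperplane_hyp/normal_neq0. Qed.

Lemma delta_sum (M : lmodType K) m (g : 'I_m -> M) k :
  \sum_l (delta_mx k 0 : 'cV[K]_m) l 0 *: g l = g k.
Proof.
rewrite (bigD1 k) //= mxE !eqxx scale1r big1 ?addr0 // => l lk.
by rewrite mxE (negPf lk) scale0r.
Qed.

Lemma normal_hesse_eq0 t i k l :
  (normal t (inl (i, k)) (lshift 2 l) 0 == 0) = (l == ordS (ordS i)).
Proof.
have wk : (w ^+ k == 0) = false by apply/negbTE/expf_neq0/w_neq0.
rewrite normal_hesse_l.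
case: i l => [[|[|[|//]]] i3] [[|[|[|//]]] l3];
by rewrite /= ?(mulr0, mulr1, subr0, sub0r) ?oppr_eq0 ?wk ?oner_eq0 ?eqxx.
Qed.

Lemma normal_hesse_i t i k : normal t (inl (i, k)) (lshift 2 i) 0 = 1.
Proof.
rewrite normal_hesse_l eqxx; case: i => [[|[|[|//]]] i3] /=; by rewrite mulr0 subr0.
Qed.

Lemma normal_hesse_i1 t i k :
  normal t (inl (i, k)) (lshift 2 (ordS i)) 0 = - w ^+ k.
Proof.
rewrite normal_hesse_l eqxx; case: i => [[|[|[|//]]] i3] /=; by rewrite mulr1 sub0r.
Qed.

(** For a plane of the dual Hesse factor, the zero entry of the coefficients
    determines the pair of coordinates and the ratio of the other two entries
    determines the cube root of unity; for the pencil it is the non-vanishing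
    of the determinants. *)
Lemma hyp_normal_inj t : t != 0 -> t != -1 -> injective (fun i => hyp (normal t i)).
Proof.
move=> t0 t1 i j /(hyp_proportional (normal_neq0 t i))[k k0 /colP nij].
have nl l := nij (lshift 2 l); have nr l := nij (rshift 3 l).
have kl l : normal t i (lshift 2 l) 0 == 0 = (normal t j (lshift 2 l) 0 == 0).
  by rewrite nl mxE mulf_eq0 (negPf k0).
case: i j {nij} kl nl nr => [[i u]|i] [[j v]|j] kl nl nr.
- have := kl (ordS (ordS i)); rewrite !normal_hesse_eq0 eqxx => /esym/eqP/ordS_inj/ordS_inj eij.
  rewrite -{j}eij in kl nl nr *.
  have := nl i; rewrite [RHS]mxE !normal_hesse_i mulr1 => k1.
  have := nl (ordS i); rewrite [RHS]mxE !normal_hesse_i1 -k1 mul1r => /oppr_inj.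
  by move/w_inj => ->.
- by have := kl i; rewrite normal_hesse_i normal_pencil_l eqxx oner_eq0.
- by have := kl j; rewrite normal_hesse_i normal_pencil_l eqxx oner_eq0.
congr inr; apply/eqP; apply: contraTT isT => /(pencil_det_neq0 t0 t1) /eqP; case.
have h0 := nr 0; have h1 := nr 1.
rewrite [RHS]mxE !normal_pencil_r /= in h0; rewrite [RHS]mxE !normal_pencil_r /= in h1.
by rewrite /pencil_det h0 h1; ring.
Qed.

Lemma normal_coprime t i j (n : nat) (X : n.-tuple V) : basis_of fullv X ->
  t != 0 -> t != -1 -> i != j ->
  ~ divides (form_mpoly X (col_form (normal t i)))
            (form_mpoly X (col_form (normal t j))).
Proof.
move=> basisX t0 t1 neqij /(divides_form_lker basisX) /(lker_sub_hom basisX).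
case=> k; rewrite -col_formZ => /col_form_inj nij; case/eqP: neqij.
apply: (hyp_normal_inj t0 t1); rewrite nij hypZ //.
by apply: contraNneq (normal_neq0 t j) => k0; rewrite nij k0 scale0r.
Qed.

Section Coord.
Variables (n : nat) (X : n.-tuple V).
Hypothesis basisX : basis_of fullv X.
Local Notation S := {mpoly K[n]}.
Implicit Type theta : 'rV[S]_n.

Local Notation x i := (xi X (lshift 2 i)).

(** The value at the linear form with coefficients [normal t i] of the linear
    map that sends the coordinate forms to [g]. *)
Definition normal_val t (g : 'I_(3 + 2) -> S) (i : index) : S :=
  match i with
  | inl (i, k) => g (lshift 2 i) - (w ^+ k)%:MP * g (lshift 2 (ordS i))
  | inr j => (pencil t j).1%:MP * g (rshift 3 0)
             + (pencil t j).2%:MP * g (rshift 3 1)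
  end.

Lemma normal_sum t i (g : 'I_(3 + 2) -> S) :
  \sum_l normal t i l 0 *: g l = normal_val t g i.
Proof.
rewrite /normal_val; case: i => [[i k]|j].
  under eq_bigr => l _ do
    rewrite mxE [X in _ + X]mxE [X in _ - X]mxE scalerBl -scalerA.
  by rewrite sumrB delta_sum -scaler_sumr delta_sum mul_mpolyC.
under eq_bigr => l _ do
  rewrite mxE [X in X + _]mxE [X in _ + X]mxE scalerDl -!scalerA.
by rewrite big_split /= -!scaler_sumr !delta_sum !mul_mpolyC.
Qed.

Lemma form_normal_val t i :
  form_mpoly X (col_form (normal t i)) = normal_val t (xi X) i.
Proof. by rewrite form_col normal_sum. Qed.

(** Tangency to the nine planes, for the values at x_0, x_1, x_2. *)
Definition hesse_compat (e : 'I_3 -> S) := forall i (k : 'I_3),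
  divides (x i - (w ^+ k)%:MP * x (ordS i)) (e i - (w ^+ k)%:MP * e (ordS i)).

Lemma hesse_factor (y z : S) :
  y ^+ 3 - z ^+ 3 = \prod_(k < 3) (y - (w ^+ k)%:MP * z).
Proof.
rewrite !big_ord_recl big_ord0 /= !(rmorph1, rmorphXn) /=.
have := congr1 (@mpolyC n K) w2E; rewrite rmorphB rmorphN rmorph1 rmorphXn /=.
by set v := w%:MP; move=> v2; rewrite /bump /= ?expr0 ?expr1; ring: v2.
Qed.

Lemma form_hesse t i k :
  form_mpoly X (col_form (normal t (inl (i, k)))) =
  x i - (w ^+ k)%:MP * x (ordS i).
Proof. exact: form_normal_val. Qed.

(** The arrangement is invariant under cyclic permutation of the coordinates,
    so that statements about the i-th plane reduce to i = 0. *)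
Lemma I3_rot (P : 'I_3 -> Prop) : P ord0 -> (forall i, P i -> P (ordS i)) ->
  forall i, P i.
Proof.
move=> P0 PS i; have P1 := PS _ P0; have P2 := PS _ P1.
case: i => [[|[|[|//]]] i3].
- by rewrite (_ : Ordinal i3 = ord0) //; apply/val_inj.
- by rewrite (_ : Ordinal i3 = ordS ord0) //; apply/val_inj.
by rewrite (_ : Ordinal i3 = ordS (ordS ord0)) //; apply/val_inj.
Qed.

Lemma ordS3 (i : 'I_3) : ordS (ordS (ordS i)) = i.
Proof. by case: i => [[|[|[|//]]] i3]; apply/val_inj. Qed.

Local Notation disc :=
  (hesse_disc (x ord0) (x (ordS ord0)) (x (ordS (ordS ord0)))).

Lemma discE i : disc = hesse_disc (x i) (x (ordS i)) (x (ordS (ordS i))).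
Proof.
elim/I3_rot: i => [|i ->]; first exact: erefl.
by rewrite hesse_disc_rot ordS3; exact: erefl.
Qed.

Lemma hesse_disc_divides f :
  (forall i (k : 'I_3), divides (x i - (w ^+ k)%:MP * x (ordS i)) f) ->
  divides disc f.
Proof.
move=> dvd.
have -> : disc = \prod_(u <- enum {: 'I_3 * 'I_3})
    form_mpoly X (col_form (normal 1 (inl u))).
  transitivity (\prod_(i < 3) \prod_(k < 3) (x i - (w ^+ k)%:MP * x (ordS i))); last first.
    by rewrite pair_bigA big_enum; apply: eq_bigr => -[i k] _; rewrite form_hesse.
  under eq_bigr do rewrite -hesse_factor.
  rewrite prod3.
  by congr ((x _ ^+ 3 - x _ ^+ 3) * (x _ ^+ 3 - x _ ^+ 3) * (x _ ^+ 3 - x _ ^+ 3));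
    apply/val_inj.
apply: coprime_forms_prod => //; first exact: enum_uniq.
- by move=> u _; apply/col_form_neq0/normal_neq0.
- move=> u v _ _ uv; apply: normal_coprime => //; first exact: oner_neq0.
  by rewrite -addr_eq0 (_ : 1 + 1 = 2%:R :> K) ?pnatr_eq0.
by move=> [i k] _; rewrite form_hesse.
Qed.

Lemma hesse_disc_neq0 : disc != 0.
Proof.
have f0 i : x i ^+ 3 - x (ordS i) ^+ 3 != 0.
  rewrite hesse_factor; apply/prodf_neq0 => k _; rewrite -(form_hesse 1).
  by apply/form_mpoly_neq0 => //; apply/col_form_neq0/normal_neq0.
have f2 := f0 (ordS (ordS ord0)); rewrite ordS3 in f2.
apply: mulf_neq0; last exact: f2.
by apply: mulf_neq0; apply: f0.
Qed.

Section Compatible.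
Variable e : 'I_3 -> S.
Hypothesis compat : hesse_compat e.

Local Notation at_rot F i := (F S (x i) (x (ordS i)) (x (ordS (ordS i)))
                                  (e i) (e (ordS i)) (e (ordS (ordS i)))).

Lemma cramer_rot0 j :
  [/\ at_rot (@cramer0) ord0 = at_rot (@cramer0) j,
      at_rot (@cramer1) ord0 = at_rot (@cramer1) j
    & at_rot (@cramer2) ord0 = at_rot (@cramer2) j].
Proof.
elim/I3_rot: j => [|j [-> -> ->]]; first by split; exact: erefl.
rewrite ordS3; exact: cramer_rot.
Qed.

Lemma cramer_divides i :
  [/\ divides disc (at_rot (@cramer0) i), divides disc (at_rot (@cramer1) i)
    & divides disc (at_rot (@cramer2) i)].
Proof.
suff vanish j k (s : {rmorphism S -> S}) : (forall c, s c%:MP = c%:MP) ->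
    s (form_mpoly X (col_form (normal 1 (inl (j, k))))) = 0 ->
    [/\ s (at_rot (@cramer0) j) = 0, s (at_rot (@cramer1) j) = 0
      & s (at_rot (@cramer2) j) = 0].
  have [i0 i1 i2] := cramer_rot0 i; rewrite -{}i0 -{}i1 -{}i2.
  split; apply: hesse_disc_divides => j k; rewrite -(form_hesse 1);
    have [r0 r1 r2] := cramer_rot0 j; rewrite ?r0 ?r1 ?r2;
    apply: (divides_form_rmorph basisX (col_form_neq0 (normal_neq0 1 _))) => s sC s0;
    by have [] := vanish j k s sC s0.
move=> sC; rewrite form_hesse rmorphB rmorphM /= sC => /eqP.
rewrite subr_eq0 => /eqP sx.
have [g /(congr1 s)] := compat j k.
rewrite [LHS]rmorphB [s (_ * e _)]rmorphM [RHS]rmorphM /= rmorphB [s (_ * x _)]rmorphM /=.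
rewrite !sC sx subrr mul0r => /eqP; rewrite subr_eq0 => /eqP se.
have wk3 : (w ^+ k)%:MP ^+ 3 = 1 :> S.
  by rewrite -rmorphXn -exprM mulnC exprM w3 expr1n.
have := cramer_vanish (s (x (ordS j))) (s (x (ordS (ordS j)))) (s (e (ordS j)))
  (s (e (ordS (ordS j)))) wk3.
have [-> -> ->] := cramer_morph s (x j) (x (ordS j)) (x (ordS (ordS j)))
                                  (e j) (e (ordS j)) (e (ordS (ordS j))).
by rewrite sx se.
Qed.

(** Saito's argument: the determinant divides the numerators of Cramer's
    rule. *)
Lemma hesse_generation : exists a b c, forall i,
  e i = a * x i + b * x i ^+ 4 + c * (x (ordS i) * x (ordS (ordS i))) ^+ 2.
Proof.
have [[a aE] [b bE] [c cE]] := cramer_divides ord0.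
exists a, b, c => i; apply: (mulfI hesse_disc_neq0).
have := cramer_rule (x i) (x (ordS i)) (x (ordS (ordS i)))
  (e i) (e (ordS i)) (e (ordS (ordS i))).
rewrite -(discE i) => ->; have [<- <- <-] := cramer_rot0 i; rewrite aE bE cE.
move: disc (x i) (x _) => d u v; ring.
Qed.

End Compatible.

Lemma hesse_independent a b c :
  (forall i, a * x i + b * x i ^+ 4 + c * (x (ordS i) * x (ordS (ordS i))) ^+ 2 = 0) ->
  [/\ a = 0, b = 0 & c = 0].
Proof.
move=> e0; have f0 := e0 (ordS ord0); have g0 := e0 (ordS (ordS ord0)).
rewrite !ordS3 in f0 g0; have [a0 b0 c0] := cramer_independent (e0 ord0) f0 g0.
by split; apply: (mulfI hesse_disc_neq0); rewrite mulr0.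
Qed.

Lemma derivation_productP t (B : {fset {vspace V}}) theta : {subset B <= product_arr t} ->
  derivation_module X B theta <->
  (forall i, hyp (normal t i) \in B ->
     divides (normal_val t (xi X) i) (normal_val t (coord_val X theta) i)).
Proof.
move=> sB; have arrB : arrangement B by move=> H /sB; apply: arrangement_product.
rewrite (derivation_moduleP basisX theta arrB); split=> [dvd i iB|dvd H HB].
  have := dvd _ iB; rewrite (divides_hyp _ _ (normal_neq0 t i)).
  by rewrite !normal_sum.
have /product_arrP[i HE] := sB _ HB; rewrite {}HE in HB *.
by rewrite (divides_hyp _ _ (normal_neq0 t i)) !normal_sum; apply: dvd.
Qed.

End Coord.
End Product.

(** * Freeness of the product *)

Lemma sum5 (M : nmodType) (F : 'I_5 -> M) :
  \sum_j F j = F (@Ordinal 5 0 isT) + F (@Ordinal 5 1 isT) + F (@Ordinal 5 2 isT)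
              + F (@Ordinal 5 3 isT) + F (@Ordinal 5 4 isT).
Proof.
rewrite !big_ord_recl big_ord0 addr0 !addrA.
by congr (F _ + F _ + F _ + F _ + F _); apply/val_inj.
Qed.

(** Multiplying the first relation by z, the second by y and subtracting
    eliminates [A] and leaves X^5 (1 - r^3) (r B - c^2 G) = 0, because y = X and
    z = r X. *)
Lemma hesse_restr_relation (K : fieldType) (A B G : {poly K}) (c r : K) : r ^+ 3 != 1 ->
  A * 'X + B * 'X ^+ 4 + G * ((r *: 'X) * (c *: 'X)) ^+ 2 = 0 ->
  A * (r *: 'X) + B * (r *: 'X) ^+ 4 + G * ((c *: 'X) * 'X) ^+ 2 = 0 ->
  r * B`_0 = c ^+ 2 * G`_0.
Proof.
move=> r3 E1 E2.
have E : (r *: 'X) * 0 - 'X * 0 = ((1 - r ^+ 3)%:P * 'X ^+ 5) * (r%:P * B - c%:P ^+ 2 * G).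
  rewrite -{1}E1 -E2 polyCB polyC_exp polyC1 -!mul_polyC.
  by move: (r%:P) (c%:P) 'X => r' c' X'; ring.
have nz : (1 - r ^+ 3)%:P * 'X ^+ 5 != 0.
  apply: mulf_neq0; first by rewrite polyC_eq0 subr_eq0 eq_sym.
  by apply: expf_neq0; rewrite polyX_eq0.
move/esym/eqP: E; rewrite !mulr0 subrr mulf_eq0 (negPf nz) /=.
move=> /eqP /(congr1 (fun P : {poly K} => P`_0)).
rewrite coefB -polyC_exp !coefCM coef0 => /eqP.
by rewrite subr_eq0 => /eqP.
Qed.

Lemma sum_relation (S : comNzRingType) m (g a b d : S) (P E F D v : 'I_m -> S) :
  \sum_j (g * P j - (a * E j + b * F j + d * D j)) * v j =
  g * (\sum_j P j * v j) - (a * (\sum_j E j * v j) + b * (\sum_j F j * v j)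
                              + d * (\sum_j D j * v j)).
Proof.
rewrite !mulr_sumr -!big_split -sumrB /=.
by apply: eq_bigr => j _; ring.
Qed.

Lemma sum_comb (S : comNzRingType) m (x y z g : S) (e v a b d : 'I_m -> S) :
  (forall j, g * v j = a j * x + b j * y + d j * z) ->
  g * (\sum_j e j * v j) = (\sum_j e j * a j) * x + (\sum_j e j * b j) * y
                           + (\sum_j e j * d j) * z.
Proof.
move=> E; rewrite mulr_sumr !mulr_suml -!big_split /=.
by apply: eq_bigr => j _; rewrite mulrCA E; ring.
Qed.

Lemma comb_shift (S : comNzRingType) (g a b d x y z : S) :
  g * y = a * x + b * y + d * z -> a * x + (b - g) * y + d * z = 0.
Proof. by move=> E; rewrite mulrBl E; ring. Qed.

Section LineRelations.
Variables (K : fieldType) (S : comNzRingType) (rho : {rmorphism S -> {poly K}}).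
Implicit Types (g v a b d e f h x y z : S).

(** Suppose that g divides the combination a E + b T + d U of the three Hesse
    derivations, and restrict the values at y and z to the line
    (x, y, z) = s (c, 1, r) in g = 0. *)
Lemma hesse_coef_relation c r g v1 v2 a b d x y z : r ^+ 3 != 1 ->
  g * v1 = a * y + b * y ^+ 4 + d * (z * x) ^+ 2 ->
  g * v2 = a * z + b * z ^+ 4 + d * (x * y) ^+ 2 ->
  rho g = 0 -> rho x = c *: 'X -> rho y = 'X -> rho z = r *: 'X ->
  r * (rho b)`_0 = c ^+ 2 * (rho d)`_0.
Proof.
move=> r3 /(congr1 rho) E1 /(congr1 rho) E2 g0 xE yE zE; move: E1 E2.
rewrite !(rmorphXn, rmorphD, rmorphM) /= g0 xE yE zE !mul0r => /esym E1 /esym E2.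
exact: hesse_restr_relation r3 E1 E2.
Qed.

Lemma extra_coef_relation g v y z e f d h :
  g * v = - (y ^+ 4 + y * z ^+ 3) * e + y * f + (h * z) * d ->
  rho g = 0 -> rho y = 'X -> rho z = 0 -> (rho f)`_0 = 0.
Proof.
move=> /(congr1 rho) E g0 yE zE; move: E.
rewrite !(rmorphXn, rmorphD, rmorphN, rmorphM) /= g0 yE zE.
rewrite expr0n /= !(mul0r, mulr0, addr0) => /esym/eqP.
rewrite addrC mulNr subr_eq0 exprS -mulrA => /eqP /(mulfI _) -> //.
  by rewrite exprS -mulrA coefXM.
by rewrite polyX_eq0.
Qed.

End LineRelations.

Section FreeProduct.
Variables (K : numFieldType) (w : K).
Hypothesis w_root : w ^+ 2 + w + 1 = 0.
Local Notation V := 'rV[K]_(3 + 2).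
Local Notation index := ('I_3 * 'I_3 + 'I_4)%type.
Local Notation normal := (normal w).
Local Notation product_arr := (product_arr w).

(** A family on the coordinates of K^5 from its parts on K^3 and K^2. *)
Definition glue (T : Type) (e : 'I_3 -> T) (f : 'I_2 -> T) (k : 'I_(3 + 2)) : T :=
  match split k with inl i => e i | inr j => f j end.

Lemma glue_l (T : Type) (e : 'I_3 -> T) f i : glue e f (lshift 2 i) = e i.
Proof. by rewrite /glue (unsplitK (inl i)). Qed.

Lemma glue_r (T : Type) (e : 'I_3 -> T) f j : glue e f (rshift 3 j) = f j.
Proof. by rewrite /glue (unsplitK (inr j)). Qed.

Section Coord.
Variables (n : nat) (X : n.-tuple V).
Hypothesis basisX : basis_of fullv X.
Local Notation S := {mpoly K[n]}.
Local Notation x i := (xi X (lshift 2 i)).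
Local Notation normal_val := (normal_val w).

Definition hesse_euler := vfield X (glue (fun i => x i) (fun=> 0)).
Definition hesse_quartic := vfield X (glue (fun i => x i ^+ 4) (fun=> 0)).
Definition hesse_dual :=
  vfield X (glue (fun i => (x (ordS i) * x (ordS (ordS i))) ^+ 2) (fun=> 0)).

(** The three Hesse derivations are tangent to all hyperplanes of the product;
    the witness factors y - v z out of y^4 - v z^4 and out of
    (z u)^2 - v (u y)^2, using v^3 = 1. *)
Lemma hesse_comb_divides (a b c : S) (g : 'I_(3 + 2) -> S) t i :
  (forall l, g (lshift 2 l) =
     a * x l + b * x l ^+ 4 + c * (x (ordS l) * x (ordS (ordS l))) ^+ 2) ->
  (forall l, g (rshift 3 l) = 0) ->
  divides (normal_val t (xi X) i) (normal_val t g i).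
Proof.
move=> gl gr; case: i => [[i k]|j] /=; last first.
  by rewrite !gr !mulr0 addr0; apply: divides0.
rewrite !gl ordS3.
have : (w ^+ k)%:MP ^+ 3 = 1 :> S.
  by rewrite -rmorphXn -exprM mulnC exprM (w3 w_root) expr1n.
move: (_%:MP) (x i) (x (ordS i)) (x (ordS (ordS i))) => v y z u v3.
exists (a + b * (y ^+ 3 + y ^+ 2 * (v * z) + y * (v * z) ^+ 2 + z ^+ 3)
        - c * u ^+ 2 * v * (y + v * z)).
ring: v3.
Qed.

Definition hesse_point (e : 'I_3 -> K) : V := \row_k glue e (fun=> 0) k.

Lemma line_restr_x (e : 'I_3 -> K) i :
  line_restr X (hesse_point e) (x i) = e i *: 'X.
Proof.
rewrite xiE line_restr_form // col_formE -colE !mxE.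
by rewrite glue_l.
Qed.

End Coord.

Section Free.
Let X := vbasis (fullv : {vspace V}).
Let n := \dim (fullv : {vspace V}).
Local Notation S := {mpoly K[n]}.
Local Notation x i := (xi X (lshift 2 i)).
Local Notation p := (xi X (rshift 3 0)).
Local Notation q := (xi X (rshift 3 1)).

Definition pencil_euler := vfield X (glue (fun=> 0) (fun j => xi X (rshift 3 j))).
(** Completes the Euler derivation to a basis for the pencil p q (p - q) (p + q):
    after subtracting a multiple of the Euler derivation, the value of a
    logarithmic derivation at p is zero, and its value at q is divisible by the
    three other forms. *)
Definition pencil_top := vfield X
  (glue (fun=> 0) (fun j => if j == 0 then 0 else q * (p - q) * (p + q))).

Definition product_basis (j : 'I_5) : 'rV[S]_n :=
  [:: hesse_euler X; hesse_quartic X; hesse_dual X; pencil_euler; pencil_top]`_j.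

Lemma pencil1_val (g : 'I_(3 + 2) -> S) :
  [/\ normal_val w 1 g (inr 0) = g (rshift 3 0),
      normal_val w 1 g (inr 1) = g (rshift 3 1),
      normal_val w 1 g (inr 2%R) = g (rshift 3 0) - g (rshift 3 1)
    & normal_val w 1 g (inr 3%R) = g (rshift 3 0) + g (rshift 3 1)].
Proof.
rewrite /normal_val; move: (g _) (g _) => u v.
by rewrite /pencil !(tnth_nth (0, 0)) /= mpolyCN mpolyC0 mpolyC1; split; ring.
Qed.

Lemma pencil1_divides f : divides q f -> divides (p - q) f -> divides (p + q) f ->
  divides (q * (p - q) * (p + q)) f.
Proof.
have basisX := vbasisP (fullv : {vspace V}).
move=> d1 d2 d3; have [_ E1 E2 E3] := pencil1_val (xi X).
rewrite -!form_normal_val in E1 E2 E3.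
have := @coprime_forms_prod _ _ _ _ basisX _ [:: 1; 2%R; 3%R : 'I_4]
  (fun j => col_form (normal 1 (inr j))) f.
rewrite !big_cons big_nil E1 E2 E3 mulr1 mulrA; apply => //.
- by move=> j _; apply/col_form_neq0/normal_neq0.
- move=> i j _ _ ij; apply: normal_coprime => //; first exact: oner_neq0.
  by rewrite -addr_eq0 (_ : 1 + 1 = 2%:R :> K) ?pnatr_eq0.
by move=> j; rewrite !inE => /or3P[] /eqP ->; rewrite ?E1 ?E2 ?E3.
Qed.

Lemma free_product : free_arrangement (product_arr 1).
Proof.
have basisX := vbasisP (fullv : {vspace V}).
have crit theta := derivation_productP (w := w) (t := 1) (B := product_arr 1)
  basisX theta (fun H h => h).
have vE i : coord_val X (hesse_euler X) i = _ := coord_val_vfield basisX _ i.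
have v4 i : coord_val X (hesse_quartic X) i = _ := coord_val_vfield basisX _ i.
have vD i : coord_val X (hesse_dual X) i = _ := coord_val_vfield basisX _ i.
have vP i : coord_val X pencil_euler i = _ := coord_val_vfield basisX _ i.
have vT i : coord_val X pencil_top i = _ := coord_val_vfield basisX _ i.
have p0 : p != 0.
  rewrite xiE; apply/form_mpoly_neq0/col_form_neq0 => //.
  by apply/eqP => /colP/(_ (rshift 3 0)); rewrite !mxE !eqxx => /eqP; rewrite oner_eq0.
exists n, X; split=> //; exists 5, product_basis; split.
- move=> j; apply/crit => i _; case: j => [[|[|[|[|[|//]]]]] j5].
  + by apply: (@hesse_comb_divides _ _ 1 0 0) => l; rewrite vE ?glue_l ?glue_r //; ring.
  + by apply: (@hesse_comb_divides _ _ 0 1 0) => l; rewrite v4 ?glue_l ?glue_r //; ring.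
  + by apply: (@hesse_comb_divides _ _ 0 0 1) => l; rewrite vD ?glue_l ?glue_r //; ring.
  + case: i => [[i k]|i] /=; rewrite !vP ?glue_l ?glue_r.
      by rewrite mulr0 subr0; apply: divides0.
    by exists 1; rewrite mulr1.
  case: i => [[i k]|i].
    by rewrite /= !vT !glue_l mulr0 subr0; apply: divides0.
  have [_ vT0 vT1] : [/\ True, coord_val X pencil_top (rshift 3 0) = 0
      & coord_val X pencil_top (rshift 3 1) = q * (p - q) * (p + q)].
    by rewrite !vT !glue_r.
  have [n0 n1 n2 n3] := pencil1_val (xi X).
  have [m0 m1 m2 m3] := pencil1_val (coord_val X pencil_top).
  have [->|->|->|->] : [\/ i = 0, i = 1, i = 2%R | i = 3%R].
    by case: i => [[|[|[|[|//]]]] i4]; [constructor 1|constructor 2|constructor 3|constructor 4];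
      apply/val_inj.
  + by rewrite m0 vT0; apply: divides0.
  + by rewrite n1 m1 vT1; exists ((p - q) * (p + q)); rewrite mulrA.
  + by rewrite n2 m2 vT0 vT1 sub0r; exists (- (q * (p + q))); rewrite mulrN mulrA [q * _]mulrC.
  by rewrite n3 m3 vT0 vT1 add0r mulrC; exists (q * (p - q)).
- move=> theta /crit dvd.
  have [|a [b [c abc]]] := hesse_generation w_root basisX (e :=
      (fun i => coord_val X theta (lshift 2 i))).
    by move=> i k; apply: (dvd (inl (i, k))); apply/product_arrP; exists (inl (i, k)).
  have dvd' i : divides (normal_val w 1 (xi X) (inr i)) _ := 
     dvd (inr i) (introT (product_arrP w 1 _) (ex_intro _ (inr i) erefl)).
  have [n0 n1 n2 n3] := pencil1_val (xi X).
  have [m0 m1 m2 m3] := pencil1_val (coord_val X theta).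
  have := dvd' 0; have := dvd' 1; have := dvd' 2%R; have := dvd' 3%R.
  rewrite {}n0 {}n1 {}n2 {}n3 {}m0 {}m1 {}m2 {}m3.
  set f0 := coord_val X theta (rshift 3 0); set f1 := coord_val X theta (rshift 3 1).
  move=> d3 d2 d1 [d f0E].
  have [|||e eE] := @pencil1_divides (f1 - q * d).
  + by apply: divides_sub d1 _; exists d.
  + have -> : f1 - q * d = (p - q) * d - (f0 - f1) by rewrite f0E; ring.
    by apply: divides_sub d2; exists d.
  + have -> : f1 - q * d = (f0 + f1) - (p + q) * d by rewrite f0E; ring.
    by apply: divides_sub d3 _; exists d.
  exists (fun j : 'I_5 => [:: a; b; c; d; e]`_j).
  apply: (coord_val_inj basisX) => l; rewrite coord_val_lin sum5 /=.
  rewrite vE v4 vD vP vT; case: (split_ordP l) => {}l ->; rewrite ?glue_l ?glue_r.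
    by rewrite !mulr0 !addr0; apply: abc.
  rewrite !mulr0 !add0r; case: (altP (l =P 0)) => [->|l0]; first by rewrite mulr0 addr0 mulrC.
  have -> : l = 1 by case: l l0 => [[|[|//]]] *; apply/val_inj.
  apply/eqP; rewrite addrC -subr_eq [d * _]mulrC; apply/eqP.
  by rewrite [e * _]mulrC -eE.
move=> c c0.
have cv l : \sum_j c j * coord_val X (product_basis j) l = 0.
  rewrite -coord_val_lin c0 /coord_val /der_apply big1 // => k _.
  by rewrite mxE mul0r.
have [|c0_0 c1_0 c2_0] := @hesse_independent _ _ w_root _ _ basisX
  (c (@Ordinal 5 0 isT)) (c (@Ordinal 5 1 isT)) (c (@Ordinal 5 2 isT)).
  move=> i; have := cv (lshift 2 i); rewrite sum5 /= vE v4 vD vP vT !glue_l.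
  by rewrite !mulr0 !addr0.
have c3_0 : c (@Ordinal 5 3 isT) = 0.
  have := cv (rshift 3 0); rewrite sum5 /= vE v4 vD vP vT !glue_r /=.
  by rewrite !mulr0 !add0r addr0 => /eqP; rewrite mulf_eq0 (negPf p0) orbF => /eqP.
have c4_0 : c (@Ordinal 5 4 isT) = 0.
  have := cv (rshift 3 1); rewrite sum5 /= vE v4 vD vP vT !glue_r c3_0.
  rewrite !mulr0 !add0r mul0r add0r => /eqP.
  have [_ n1 n2 n3] := pencil1_val (xi X).
  have f0 j : normal_val w 1 (xi X) (inr j) != 0.
    by rewrite -form_normal_val; apply/form_mpoly_neq0/col_form_neq0/normal_neq0.
  have := f0 1; have := f0 2%R; have := f0 3%R; rewrite n1 n2 n3 => f3 f2 f1.
  by rewrite !mulf_eq0 (negPf f1) (negPf f2) (negPf f3) !orbF => /eqP.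
by case=> [[|[|[|[|[|//]]]]] j5]; [move: c0_0|move: c1_0|move: c2_0|move: c3_0|move: c4_0];
  move=> <-; congr c; apply/val_inj.
Qed.

End Free.

(** * Deletions of planes of the dual Hesse factor are not free *)

Section NonFree.
Variables (n : nat) (X : n.-tuple V).
Hypothesis basisX : basis_of fullv X.
Local Notation S := {mpoly K[n]}.
Local Notation x i := (xi X (lshift 2 i)).
Variables (t : K) (B : {fset {vspace V}}) (i k : 'I_3).
Hypotheses (t0 : t != 0) (t1 : t != -1).
Hypothesis sub_B : {subset B <= product_arr t}.
Hypothesis hesse_sub : forall u, hyp (normal t (inl u)) \in B.

Let H0 := hyp (normal t (inl (i, k))).
Let c : K := w ^+ k.
Let alpha : S := x i - c%:MP * x (ordS i).
Let y := x (ordS i).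
Let z := x (ordS (ordS i)).

Lemma deletion_sub : {subset B `\ H0 <= product_arr t}.
Proof. by move=> H; rewrite in_fsetD1 => /andP[_]; apply: sub_B. Qed.

Let critP := fun theta => derivation_productP (w := w) basisX theta deletion_sub.

Lemma deletion_compat theta : derivation_module X (B `\ H0) theta ->
  hesse_compat w X (fun l => alpha * coord_val X theta (lshift 2 l)).
Proof.
move=> /critP dvd j l; rewrite [_%:MP * (alpha * _)]mulrCA -mulrBr.
have [[-> ->]|ne] := eqVneq (j, l) (i, k).
  by apply: divides_mulr; exists 1; rewrite mulr1.
apply: divides_mull; apply: (dvd (inl (j, l))); rewrite in_fsetD1 hesse_sub andbT.
by apply: contra ne => /eqP /(hyp_normal_inj w_root t0 t1) [-> ->].
Qed.

Lemma hesse_comb_deletion (a b d : S) theta :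
  (forall l, coord_val X theta (lshift 2 l) =
     a * x l + b * x l ^+ 4 + d * (x (ordS l) * x (ordS (ordS l))) ^+ 2) ->
  (forall l, coord_val X theta (rshift 3 l) = 0) ->
  derivation_module X (B `\ H0) theta.
Proof. by move=> vl vr; apply/critP => j _; apply: hesse_comb_divides vl vr. Qed.

(** The values of (y T + c z U - (y^4 + y z^3) E) / (x - c y), with E, T, U the
    Hesse derivations.  If a combination a E + b T + d U vanishes on x = c y, then
    b z = c^2 d y there; b = y and d = c z is the solution of least degree. *)
Definition extra_val (l : 'I_3) : S :=
  if l == i then x i * y * (x i ^+ 2 + c%:MP * x i * y + c%:MP ^+ 2 * y ^+ 2) - y * z ^+ 3
  else if l == ordS i then c%:MP * z ^+ 3 * (x i + c%:MP * y)
  else c%:MP * z * y ^+ 2 * (x i + c%:MP * y).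

Definition extra := vfield X (glue extra_val (fun=> 0)).

Lemma extra_relation l : alpha * extra_val l =
  - (y ^+ 4 + y * z ^+ 3) * x l + y * x l ^+ 4
  + (c%:MP * z) * (x (ordS l) * x (ordS (ordS l))) ^+ 2.
Proof.
have c3 : c%:MP ^+ 3 = 1 :> S.
  by rewrite -rmorphXn -exprM mulnC exprM (w3 w_root) expr1n.
have [->|->|->] : [\/ l = i, l = ordS i | l = ordS (ordS i)].
- by case: l i => [[|[|[|//]]] l3] [[|[|[|//]]] i3];
    try (by constructor 1; apply/val_inj); try (by constructor 2; apply/val_inj);
    constructor 3; apply/val_inj.
- rewrite /extra_val eqxx /alpha -/y -/z.
  move: (_%:MP) c3 (x i) y z => v v3 a b d; ring: v3.
- have ne : (ordS i == i) = false by case: i => [[|[|[|]]]].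
  rewrite /extra_val ne eqxx /alpha ordS3 -/y -/z.
  move: (_%:MP) c3 (x i) y z => v v3 a b d; ring: v3.
have ne : (ordS (ordS i) == i) = false by case: i => [[|[|[|]]]].
have ne' : (ordS (ordS i) == ordS i) = false by case: i => [[|[|[|]]]].
rewrite /extra_val ne ne' /alpha !ordS3 -/y -/z.
move: (_%:MP) c3 (x i) y z => v v3 a b d; ring: v3.
Qed.

(** On the remaining hyperplanes, x - c y times this derivation is a
    combination of tangent ones, and x - c y is prime to their forms. *)
Lemma extra_deletion : derivation_module X (B `\ H0) extra.
Proof.
apply/critP => u uB; have ne : inl (i, k) != u.
  by apply: contraTneq uB => <-; rewrite in_fsetD1 eqxx.
have vX := coord_val_vfield basisX (glue extra_val (fun=> 0)).
have alphaE : normal_val w t (xi X) (inl (i, k)) = alpha by [].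
have dvd : divides (normal_val w t (xi X) u) (alpha * normal_val w t (coord_val X extra) u).
  have -> : alpha * normal_val w t (coord_val X extra) u =
      normal_val w t (fun l => alpha * coord_val X extra l) u.
    by case: (u) => [[j l]|j] /=; move: (coord_val X extra) => g; ring.
  apply: (hesse_comb_divides (a := - (y ^+ 4 + y * z ^+ 3)) (b := y)
     (c := c%:MP * z)) => l; rewrite vX ?glue_l ?glue_r; last by rewrite mulr0.
  exact: extra_relation.
rewrite -form_normal_val in dvd *.
case/(form_mpoly_prime basisX (col_form_neq0 (normal_neq0 w t u))): dvd => //.
rewrite -alphaE -form_normal_val => /(normal_coprime w_root basisX t0 t1); case.
by rewrite eq_sym.
Qed.

(** Directions of lines contained in the plane x = c y. *)
Let H0_point (r : K) : V :=
  hesse_point (fun l => if l == i then c else if l == ordS i then 1 else r).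

Lemma H0_point_restr r :
  [/\ line_restr X (H0_point r) (x i) = c *: 'X,
      line_restr X (H0_point r) y = 'X, line_restr X (H0_point r) z = r *: 'X
    & line_restr X (H0_point r) alpha = 0].
Proof.
have ne1 : (ordS i == i) = false by case: i => [[|[|[|]]]].
have ne2 : (ordS (ordS i) == i) = false by case: i => [[|[|[|]]]].
have ne3 : (ordS (ordS i) == ordS i) = false by case: i => [[|[|[|]]]].
have Ei : line_restr X (H0_point r) (x i) = c *: 'X.
  by rewrite line_restr_x // eqxx.
have Ey : line_restr X (H0_point r) y = 'X.
  by rewrite line_restr_x // ne1 eqxx scale1r.
split=> //; first by rewrite line_restr_x // ne2 ne3.
rewrite rmorphB rmorphM /= Ei Ey.
by rewrite line_restrC // mul_polyC subrr.
Qed.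

(** On the line s (c, 1, r) the two relations give r b(0) = c^2 d(0), whenever
    r^3 <> 1.  Take r = 0, then r = -1. *)
Lemma deletion_coef0 theta a b d : derivation_module X (B `\ H0) theta ->
  (forall l, alpha * coord_val X theta (lshift 2 l) =
     a * x l + b * x l ^+ 4 + d * (x (ordS l) * x (ordS (ordS l))) ^+ 2) ->
  forall v, (line_restr X v b)`_0 = 0.
Proof.
move=> thetaD E v.
have rel r : r ^+ 3 != 1 ->
    r * (line_restr X v b)`_0 = c ^+ 2 * (line_restr X v d)`_0.
  move=> r3; rewrite !(line_restr0 X v (H0_point r)).
  have [Ei Ey Ez E0] := H0_point_restr r.
  have E1 := E (ordS i); have E2 := E (ordS (ordS i)).
  rewrite !ordS3 in E1 E2.
  exact: hesse_coef_relation r3 E1 E2 E0 Ei Ey Ez.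
have d0 : (line_restr X v d)`_0 = 0.
  have /rel : (0 : K) ^+ 3 != 1 by rewrite expr0n eq_sym oner_eq0.
  have c2 : c ^+ 2 != 0 by apply/expf_neq0/expf_neq0/w_neq0.
  by rewrite mul0r => /esym/eqP; rewrite mulf_eq0 (negPf c2) => /eqP.
have /rel : (-1 : K) ^+ 3 != 1.
  rewrite -signr_odd /= expr1 eq_sym -addr_eq0 (_ : 1 + 1 = 2%:R :> K) ?pnatr_eq0 //.
by rewrite d0 mulr0 mulN1r => /eqP; rewrite oppr_eq0 => /eqP.
Qed.

(** The contradiction between [e4_0], where the relation between the four
    derivations forces the coordinates of the quartic one into the maximal
    ideal of the origin, and [deletion_coef0]: the form x - c y would lie in the
    square of that ideal. *)
Lemma deletion_not_free m (b : 'I_m -> 'rV[S]_n) :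
  ~ derivation_basis X (B `\ H0) b.
Proof.
case=> bD gen free.
have vE := coord_val_vfield basisX (glue (fun l => x l) (fun=> 0)).
have v4 := coord_val_vfield basisX (glue (fun l => x l ^+ 4) (fun=> 0)).
have vD := coord_val_vfield basisX
  (glue (fun l => (x (ordS l) * x (ordS (ordS l))) ^+ 2) (fun=> 0)).
have vX := coord_val_vfield basisX (glue extra_val (fun=> 0)).
have [|eE eEE] := gen (hesse_euler X).
  by apply: (@hesse_comb_deletion 1 0 0) => l; rewrite vE ?glue_l ?glue_r //; ring.
have [|e4 e4E] := gen (hesse_quartic X).
  by apply: (@hesse_comb_deletion 0 1 0) => l; rewrite v4 ?glue_l ?glue_r //; ring.
have [|eD eDE] := gen (hesse_dual X).
  by apply: (@hesse_comb_deletion 0 0 1) => l; rewrite vD ?glue_l ?glue_r //; ring.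
have [eX eXE] := gen _ extra_deletion.
(* By freeness, [extra_relation] holds between coordinates. *)
have rel j : alpha * eX j =
    - (y ^+ 4 + y * z ^+ 3) * eE j + y * e4 j + (c%:MP * z) * eD j.
  apply/eqP; rewrite -subr_eq0; apply/eqP; move: j; apply: free.
  apply: (coord_val_inj basisX) => l; rewrite coord_val_lin.
  have -> : coord_val X 0 l = 0.
    by rewrite /coord_val /der_apply big1 // => j _; rewrite mxE mul0r.
  rewrite sum_relation -!coord_val_lin -eEE -e4E -eDE -eXE.
  rewrite vE v4 vD vX; case: (split_ordP l) => {}l ->; rewrite ?glue_l ?glue_r.
    by rewrite extra_relation subrr.
  by rewrite !mulr0 !addr0 subrr.
have e4_0 j v : (line_restr X v (e4 j))`_0 = 0.
  rewrite (line_restr0 X v (H0_point 0)).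
  have [Ei Ey Ez E0] := H0_point_restr 0.
  by rewrite scale0r in Ez; apply: extra_coef_relation (rel j) E0 Ey Ez.
have coef j : exists u : S * S * S, forall l, alpha * coord_val X (b j) (lshift 2 l) =
    u.1.1 * x l + u.1.2 * x l ^+ 4 + u.2 * (x (ordS l) * x (ordS (ordS l))) ^+ 2.
  have [u [u' [u'' uE]]] := hesse_generation w_root basisX (deletion_compat (bD j)).
  by exists (u, u', u'').
have [u uE] := fin_all_exists coef.
have [|_ sumE _] := @hesse_independent _ _ w_root _ _ basisX
  (\sum_j e4 j * (u j).1.1) (\sum_j e4 j * (u j).1.2 - alpha) (\sum_j e4 j * (u j).2).
  move=> l; have := sum_comb e4 (fun j => uE j l).
  by rewrite -coord_val_lin -e4E v4 glue_l; apply: comb_shift.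
move/eqP: sumE; rewrite subr_eq0 => /eqP sumE.
(* On the x-axis alpha restricts to X, which has order one. *)
pose v := hesse_point (fun l => if l == i then 1 else 0).
have alphaX : line_restr X v alpha = 'X.
  have ne1 : (ordS i == i) = false by case: i => [[|[|[|]]]].
  rewrite rmorphB rmorphM /= !line_restr_x // ne1 eqxx scale0r mulr0 subr0.
  by rewrite scale1r.
have := congr1 (fun f => (line_restr X v f)`_1) sumE; rewrite alphaX coefX eqxx.
rewrite rmorph_sum coef_sum big1 => [/eqP|j _]; first by rewrite eq_sym oner_eq0.
rewrite rmorphM coefM !big_ord_recl big_ord0 /= e4_0 (deletion_coef0 (bD j) (uE j)).
by rewrite mul0r mulr0 !addr0.
Qed.

End NonFree.
End FreeProduct.

(** * The product is not inductively free *)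

Lemma inductively_free_inv (K : fieldType) (V : vectType K) (A : {fset {vspace V}}) :
  inductively_free A -> A = fset0 \/
  exists H0, [/\ H0 \in A, inductively_free (A `\ H0) & exists e, exponents (A `\ H0) e].
Proof.
case=> [V'|V' A' H0 e'' e' _ H0A _ IFA _ expA _]; first by left.
by right; exists H0; split=> //; exists e'.
Qed.

Section NotInductivelyFree.
Variables (K : numFieldType) (w : K).
Hypothesis w_root : w ^+ 2 + w + 1 = 0.
Local Notation V := 'rV[K]_(3 + 2).
Local Notation normal := (normal w).
Local Notation product_arr := (product_arr w).

(** Induction on the number of hyperplanes: the last addition of an inductive
    construction adds either a line of the pencil, and the rest is smaller, or
    a plane of the dual Hesse factor, and the rest is not free. *)
Lemma product_not_inductively_free t (B : {fset {vspace V}}) :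
  t != 0 -> t != -1 -> {subset B <= product_arr t} ->
  (forall u, hyp (normal t (inl u)) \in B) -> ~ inductively_free B.
Proof.
move=> t0 t1; have [N] := ubnP #|` B|; elim: N B => // N IH B leB sB hB.
case/inductively_free_inv => [B0|[H0 [H0B IFB [e [n [X [basisX [m [b [d [bB _ _]]]]]]]]]]].
  by have := hB (ord0, ord0); rewrite B0 in_fset0.
have /product_arrP[[[i k]|j] H0E] := sB _ H0B; rewrite {}H0E in H0B IFB bB.
  exact: (deletion_not_free w_root basisX t0 t1 sB hB) bB.
apply: IH IFB.
- by rewrite (cardfsD1 (hyp (normal t (inr j)))) H0B in leB.
- by move=> H /fsetD1P[_]; apply: sB.
move=> u; rewrite in_fsetD1 hB andbT.
by apply/eqP => /(hyp_normal_inj w_root t0 t1).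
Qed.

End NotInductivelyFree.

(** * Isomorphic intersection lattices *)

Section LatticeFamily.
Variables (K : fieldType) (V W : vectType K) (I : finType).
Variables (a : I -> {vspace V}) (b : I -> {vspace W}).

Lemma mem_intersection_lattice (V' : vectType K) (c : I -> {vspace V'}) X :
  reflect (exists J : {set I}, X = \bigcap_(j in J) c j)%VS
          (X \in intersection_lattice [fset c i | i in {: I}]).
Proof.
have bigE (B : {fset {vspace V'}}) (J : {set I}) : B = [fset c i | i in J] ->
    (\bigcap_(H <- B) H = \bigcap_(j in J) c j)%VS.
  move=> BE; rewrite big_seq_fsetE /=; apply/eqP; rewrite eqEsubv.
  apply/andP; split; apply/subv_bigcapP.
    move=> j jJ; have cB : c j \in B by rewrite BE; apply/imfsetP; exists j.
    exact: (bigcapv_inf [` cB] isT).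
  move=> [H /= HB] _; have := HB; rewrite {1}BE => /imfsetP[j /= jJ ->].
  exact: (bigcapv_inf j jJ).
apply: (iffP (imfsetP _ _ _ _)) => [[B]|[J ->]].
  rewrite /= fpowersetE => /fsubsetP sB ->; exists [set i | c i \in B].
  apply: bigE; apply/fsetP => H; apply/idP/imfsetP => [HB|[i /=]].
    have /imfsetP[i _ HE] := sB H HB; exists i => //.
    by rewrite /= inE -HE.
  by rewrite inE => iB ->.
exists [fset c i | i in J]; last by apply/esym/bigE.
rewrite /= fpowersetE; apply/fsubsetP => _ /imfsetP[i _ ->].
by apply/imfsetP; exists i.
Qed.

(** The lattice of flats depends only on which hyperplanes contain which
    intersections of subfamilies: the isomorphism sends X to the intersection of
    the [b i] for the [a i] containing X. *)
Lemma lattice_isomorphic_family :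
  (forall (J : {set I}) i,
    (\bigcap_(j in J) a j <= a i)%VS = (\bigcap_(j in J) b j <= b i)%VS) ->
  lattice_isomorphic [fset a i | i in {: I}] [fset b i | i in {: I}].
Proof.
move=> ab; pose phi X := (\bigcap_(i | (X <= a i)%VS) b i)%VS.
have phiE (J : {set I}) : phi (\bigcap_(j in J) a j)%VS = (\bigcap_(j in J) b j)%VS.
  apply/eqP; rewrite eqEsubv; apply/andP; split; apply/subv_bigcapP => i.
    by move=> iJ; apply: (bigcapv_inf i) => //; apply: (bigcapv_inf i iJ).
  by rewrite ab.
exists phi; split.
  apply/fsetP => Y; apply/imfsetP/mem_intersection_lattice.
    by move=> [X /mem_intersection_lattice[J ->] ->]; exists J.
  move=> [J ->]; exists (\bigcap_(j in J) a j)%VS => //.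
  by apply/mem_intersection_lattice; exists J.
move=> _ _ /mem_intersection_lattice[J ->] /mem_intersection_lattice[J' ->].
rewrite !phiE; apply/subv_bigcapP/subv_bigcapP => sub i iJ; have := sub i iJ.
  by rewrite ab.
by rewrite ab.
Qed.

End LatticeFamily.

Section Moduli.
Variables (K : numFieldType) (w : K).
Hypothesis w_root : w ^+ 2 + w + 1 = 0.
Local Notation V := 'rV[K]_(3 + 2).
Local Notation index := ('I_3 * 'I_3 + 'I_4)%type.
Local Notation normal := (normal w).
Local Notation product_arr := (product_arr w).

Lemma mem_hyp_normal t i (v : V) : (v \in hyp (normal t i)) =
  (match i with
   | inl (i, k) => v 0 (lshift 2 i) - w ^+ k * v 0 (lshift 2 (ordS i))
   | inr j => (pencil t j).1 * v 0 (rshift 3 0) + (pencil t j).2 * v 0 (rshift 3 1)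
   end == 0).
Proof.
rewrite mem_hyp /normal; case: i => [[i k]|j].
  by rewrite mulmxBr -scalemxAr -!colE !mxE.
by rewrite mulmxDr -!scalemxAr -!colE !mxE.
Qed.

(** A condition from the dual Hesse factor does not see the last two
    coordinates, and setting these to zero fulfils all conditions from the
    pencil.  A line of the pencil contains the intersection iff it is a member
    of the family or the family has two distinct members in the pencil, which
    forces p = q = 0. *)
Lemma subv_hyp_normal t t' (J : {set index}) i :
  t != 0 -> t != -1 -> t' != 0 -> t' != -1 ->
  (\bigcap_(j in J) hyp (normal t j) <= hyp (normal t i))%VS ->
  (\bigcap_(j in J) hyp (normal t' j) <= hyp (normal t' i))%VS.
Proof.
move=> t0 t1 t'0 t'1 /subvP sub; apply/subvP => v vJ'.
have {}vJ' j : j \in J -> v \in hyp (normal t' j).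
  move=> jJ; have /subvP : (\bigcap_(j in J) hyp (normal t' j) <= hyp (normal t' j))%VS.
    exact: (bigcapv_inf j jJ).
  exact.
have {}sub u : (forall j, j \in J -> u \in hyp (normal t j)) -> u \in hyp (normal t i).
  by move=> uJ; apply: sub; rewrite memvE; apply/subv_bigcapP => j /uJ; rewrite memvE.
case: i sub => [[i k]|j] sub.
  have := sub (\row_l glue (fun l => v 0 (lshift 2 l)) (fun=> 0) l).
  rewrite !mem_hyp_normal !mxE !glue_l; apply => -[[l m]|l] lJ.
    by have := vJ' _ lJ; rewrite !mem_hyp_normal !mxE !glue_l.
  by rewrite mem_hyp_normal !mxE !glue_r !mulr0 addr0.
have [jJ|jJ] := boolP (inr j \in J); first exact: vJ'.
have [l /andP[lj /forallP Jl]|none] :=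
    pickP [pred l | (l != j) && [forall l', (inr l' \in J) ==> (l' == l)]].
  (* v0 spans the line of the plane on which the l-th form vanishes *)
  pose v0 : V := \row_l' glue (fun=> 0) (fun m : 'I_2 =>
    if m == 0 then (pencil t l).2 else - (pencil t l).1) l'.
  have v0J : forall u, u \in J -> v0 \in hyp (normal t u).
    move=> [[l1 m1]|l'] l'J; rewrite mem_hyp_normal !mxE ?glue_l ?glue_r /=.
      by rewrite mulr0 subr0.
    by have := Jl l'; rewrite l'J => /eqP ->; apply/eqP; ring.
  have := sub v0 v0J; rewrite mem_hyp_normal !mxE !glue_r /= => /eqP d0.
  case/negP: (pencil_det_neq0 t0 t1 lj).
  by rewrite -oppr_eq0 -[X in _ == X]d0 /pencil_det; apply/eqP; ring.
have [l lJ] : exists l, inr l \in J.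
  apply/existsP; have := none (ordS j); rewrite inE /=.
  have -> /= : ordS j != j by case: (j) => [[|[|[|[|]]]]].
  move/negbT; rewrite negb_forall => /existsP[l]; rewrite negb_imply => /andP[lJ _].
  by apply/existsP; exists l.
have [l' l'J ll'] : exists2 l', inr l' \in J & l' != l.
  have := none l; rewrite inE /=.
  have -> /= : l != j by apply: contraNneq jJ => <-.
  move/negbT; rewrite negb_forall => /existsP[l']; rewrite negb_imply => /andP[]; by exists l'.
have := vJ' _ lJ; have := vJ' _ l'J; rewrite !mem_hyp_normal => /eqP E' /eqP E.
have d0 := pencil_det_neq0 t'0 t'1 ll'.
suff [-> ->] : v 0 (rshift 3 0) = 0 /\ v 0 (rshift 3 1) = 0 by rewrite !mulr0 addr0.
split; apply: (mulfI d0); rewrite mulr0 /pencil_det.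
  transitivity ((pencil t' l).2 * 0 - (pencil t' l').2 * 0); last by rewrite !mulr0 subrr.
  by rewrite -{1}E' -E; ring.
transitivity ((pencil t' l').1 * 0 - (pencil t' l).1 * 0); last by rewrite !mulr0 subrr.
by rewrite -{1}E -E'; ring.
Qed.

Lemma product_lattice t t' : t != 0 -> t != -1 -> t' != 0 -> t' != -1 ->
  lattice_isomorphic (product_arr t) (product_arr t').
Proof.
move=> t0 t1 t'0 t'1; apply: lattice_isomorphic_family => J i.
by apply/idP/idP; apply: subv_hyp_normal.
Qed.

(** * The product is not rigid *)

(** Harmonicity of (f_i, f_j; f_k, f_l) is the vanishing of this expression,
    which is homogeneous in each of the four forms.  The pencil for t = 2 has
    integral coefficients, so that the claim is a computation with integers. *)
Lemma pencil2_bracket (i j k l : 'I_4) : uniq [:: i; j; k; l] ->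
  pencil_det (2 : K) i k * pencil_det 2 j l + pencil_det 2 i l * pencil_det 2 j k != 0.
Proof.
pose zp := [:: (1, 0); (0, 1); (1, -1); (1, 2)] : seq (int * int).
pose zdet (a b : nat) : int := (nth (0, 0) zp a).1 * (nth (0, 0) zp b).2
                      - (nth (0, 0) zp a).2 * (nth (0, 0) zp b).1.
have detE a b : pencil_det (2 : K) a b = (zdet a b)%:~R.
  have pE (c : 'I_4) : ((nth (0, 0) zp c).1%:~R = (pencil (2 : K) c).1) /\
                       ((nth (0, 0) zp c).2%:~R = (pencil (2 : K) c).2).
    by rewrite /pencil (tnth_nth (0, 0)); case: c => [[|[|[|[|//]]]] c4].
  by rewrite /pencil_det rmorphB !rmorphM /=; have [-> ->] := pE a; have [-> ->] := pE b.
rewrite !detE -!rmorphM -rmorphD intr_eq0.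
by case: i j k l => [[|[|[|[|//]]]] ?] [[|[|[|[|//]]]] ?] [[|[|[|[|//]]]] ?]
  [[|[|[|[|//]]]] ?].
Qed.

(** The mixed cases are excluded by looking at which coordinates vanish.  For
    four planes of the dual Hesse factor: if the first two involve different
    pairs of coordinates, then both combinations have to cancel the one
    coordinate in common, which is impossible for a sum and a difference;
    otherwise all four involve the same pair of coordinates, but there are only
    three cube roots of unity. *)
Lemma no_harmonic_quadruple (u0 u1 u2 u3 : index) (k0 k1 k2 k3 : K) :
  uniq [:: u0; u1; u2; u3] -> k0 != 0 -> k1 != 0 -> k2 != 0 -> k3 != 0 ->
  k2 *: normal 2 u2 = k0 *: normal 2 u0 - k1 *: normal 2 u1 ->
  k3 *: normal 2 u3 = k0 *: normal 2 u0 + k1 *: normal 2 u1 -> False.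
Proof.
move=> uu k0_n k1_n k2_n k3_n /colP E2 /colP E3.
have {}E2 l : k2 * normal 2 u2 l 0 = k0 * normal 2 u0 l 0 - k1 * normal 2 u1 l 0.
  by have := E2 l; rewrite !mxE.
have {}E3 l : k3 * normal 2 u3 l 0 = k0 * normal 2 u0 l 0 + k1 * normal 2 u1 l 0.
  by have := E3 l; rewrite !mxE.
have k0f (k e : K) : k != 0 -> k * e = 0 -> e = 0.
  by move=> kn /eqP; rewrite mulf_eq0 (negPf kn) => /eqP.
have pair0 k j : k != 0 -> (forall l, k * normal 2 (inr j) (rshift 3 l) 0 = 0) -> False.
  move=> kn E; have := E 0; have := E 1; rewrite !normal_pencil_r /=.
  by move=> /(k0f _ _ kn) e1 /(k0f _ _ kn) e0; apply: pencil_neq0 e0 e1.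
have one k u : k != 0 -> (forall l, k * normal 2 (inl u) (lshift 2 l) 0 = 0) -> False.
  case: u => i c kn E; have := E i; rewrite normal_hesse_i mulr1 => /eqP.
  by rewrite (negPf kn).
have L2 l := E2 (lshift 2 l); have L3 l := E3 (lshift 2 l).
have R2 l := E2 (rshift 3 l); have R3 l := E3 (rshift 3 l).
clear E2 E3.
case: u0 u1 uu L2 L3 R2 R3 => [[i0 c0]|j0] [[i1 c1]|j1] uu L2 L3 R2 R3.
- case: u2 uu L2 R2 => [[i2 c2]|j2] uu L2 R2; last first.
    by apply: (pair0 k2 j2 k2_n) => l; rewrite R2 !normal_hesse_r !mulr0 subrr.
  case: u3 uu L3 R3 => [[i3 c3]|j3] uu L3 R3; last first.
    by apply: (pair0 k3 j3 k3_n) => l; rewrite R3 !normal_hesse_r !mulr0 addr0.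
  pose f i c l := normal 2 (inl (i, c)) (lshift 2 l) 0.
  have f0 i c l : (f i c l == 0) = (l == ordS (ordS i)) by exact: normal_hesse_eq0.
  have fz i c : f i c (ordS (ordS i)) = 0 by apply/eqP; rewrite f0.
  have fk0 k i c l : k != 0 -> k * f i c l = 0 -> l = ordS (ordS i).
    by move=> kn /(k0f _ _ kn)/eqP; rewrite f0 => /eqP.
  rewrite -!/(f _ _ _) in L2 L3.
  have {}L2 l : k2 * f i2 c2 l = k0 * f i0 c0 l - k1 * f i1 c1 l by exact: L2.
  have {}L3 l : k3 * f i3 c3 l = k0 * f i0 c0 l + k1 * f i1 c1 l by exact: L3.
  have zinj : injective (fun i : 'I_3 => ordS (ordS i)) by move=> i j /ordS_inj/ordS_inj.
  have [i01|i01] := eqVneq i0 i1.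
    rewrite -i01 in uu L2 L3.
    have i2E : i0 = i2.
      by apply/zinj/(fk0 k2 _ c2) => //; rewrite L2 !fz !mulr0 subrr.
    have i3E : i0 = i3.
      by apply/zinj/(fk0 k3 _ c3) => //; rewrite L3 !fz !mulr0 addr0.
    rewrite -i2E -i3E in uu.
    have {}uu : uniq [:: c0; c1; c2; c3].
      by rewrite -(map_inj_uniq (f := fun c => inl (i0, c) : index)) // => c c' [].
    by have := max_card (mem [:: c0; c1; c2; c3]); rewrite (card_uniqP uu) card_ord.
  have z01 : ordS (ordS i0) <> ordS (ordS i1) by move/zinj/eqP; rewrite (negPf i01).
  have z20 : ordS (ordS i2) <> ordS (ordS i0).
    move=> z; apply: z01; apply: (fk0 k1 _ c1) => //; apply/eqP.
    have := L2 (ordS (ordS i0)); rewrite -{1}z !fz !mulr0 sub0r => /esym/eqP.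
    by rewrite oppr_eq0.
  have z21 : ordS (ordS i2) <> ordS (ordS i1).
    move=> z; apply/z01/esym; apply: (fk0 k0 _ c0) => //.
    by have := L2 (ordS (ordS i1)); rewrite -{1}z !fz !mulr0 subr0.
  have z30 : ordS (ordS i3) <> ordS (ordS i0).
    move=> z; apply: z01; apply: (fk0 k1 _ c1) => //.
    by have := L3 (ordS (ordS i0)); rewrite -{1}z !fz !mulr0 add0r.
  have z31 : ordS (ordS i3) <> ordS (ordS i1).
    move=> z; apply/z01/esym; apply: (fk0 k0 _ c0) => //.
    by have := L3 (ordS (ordS i1)); rewrite -{1}z !fz !mulr0 addr0.
  have z23 : ordS (ordS i2) = ordS (ordS i3).
    move: z01 z20 z21 z30 z31; move: (ordS (ordS i0)) (ordS (ordS i1)).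
    move: (ordS (ordS i2)) (ordS (ordS i3)).
    move=> [[|[|[|//]]] ?] [[|[|[|//]]] ?] [[|[|[|//]]] ?] [[|[|[|//]]] ?] *;
      apply/val_inj => //=; exfalso;
      by match goal with h : ?x <> ?y |- _ => apply: h; exact/val_inj end.
  have := L2 (ordS (ordS i2)); have := L3 (ordS (ordS i2)).
  rewrite fz {1}z23 fz !mulr0 => e3 e2.
  apply: z20; apply: (fk0 (k0 *+ 2) _ c0); first by rewrite mulrn_eq0.
  transitivity (0 + 0 : K); last by rewrite addr0.
  by rewrite {1}e3 e2; ring.
- case: u2 uu L2 R2 => [u2|j2] uu L2 R2.
    apply: (pair0 k1 j1 k1_n) => l; have := R2 l.
    case: (u2) => ? ?; rewrite !normal_hesse_r !mulr0 sub0r => /esym/eqP.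
    by rewrite oppr_eq0 => /eqP.
  apply: (one k0 (i0, c0) k0_n) => l; have := L2 l.
  by rewrite !normal_pencil_l !mulr0 subr0 => <-.
- case: u2 uu L2 R2 => [u2|j2] uu L2 R2.
    apply: (pair0 k0 j0 k0_n) => l; have := R2 l.
    by case: (u2) => ? ?; rewrite !normal_hesse_r !mulr0 subr0 => <-.
  apply: (one k1 (i1, c1) k1_n) => l; have := L2 l.
  by rewrite !normal_pencil_l !mulr0 sub0r => /esym/eqP; rewrite oppr_eq0 => /eqP.
case: u2 uu L2 R2 => [u2|j2] uu L2 R2.
  by apply: (one k2 u2 k2_n) => l; rewrite L2 !normal_pencil_l !mulr0 subrr.
case: u3 uu L3 R3 => [u3|j3] uu L3 R3.
  by apply: (one k3 u3 k3_n) => l; rewrite L3 !normal_pencil_l !mulr0 addr0.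
have {}uu : uniq [:: j0; j1; j2; j3] by exact: uu.
case/negP: (pencil2_bracket uu); apply/eqP.
have := R2 0; have := R2 1; have := R3 0; have := R3 1.
rewrite !normal_pencil_r /= /pencil_det.
move: (pencil 2 j0) (pencil 2 j1) (pencil 2 j2) (pencil 2 j3).
move=> [p0 q0] [p1 q1] [p2 q2] [p3 q3] /= a b c d.
apply: (mulfI (mulf_neq0 k2_n k3_n)); rewrite mulr0.
transitivity ((p0 * (k2 * q2) - q0 * (k2 * p2)) * (p1 * (k3 * q3) - q1 * (k3 * p3))
  + (p0 * (k3 * q3) - q0 * (k3 * p3)) * (p1 * (k2 * q2) - q1 * (k2 * p2))); first by ring.
by rewrite a b c d; ring.
Qed.

Lemma limg_hyp (r : nat) (g : 'M[K]_r) (a : 'cV[K]_r) : g \in unitmx ->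
  (linfun (mulmxr g : 'rV[K]_r -> 'rV[K]_r) @: hyp a)%VS = hyp (invmx g *m a).
Proof.
move=> gU; apply/vspaceP => v; rewrite mem_hyp; apply/memv_imgP/eqP.
  by case=> u; rewrite mem_hyp lfunE /= => /eqP ua ->; rewrite mulmxA mulmxK.
move=> va; exists (v *m invmx g); last by rewrite lfunE /= mulmxKV.
by rewrite mem_hyp -mulmxA va.
Qed.

(** The form chosen for the hyperplane is a multiple [k *: a], whose conjugate is
    [sigma k *: a]. *)
Lemma conj_hyp (r : nat) (sigma : {rmorphism K -> K}) (a : 'cV[K]_r) : a != 0 ->
  map_mx sigma a = a -> conj_hyperplane sigma (hyp a) = hyp a.
Proof.
move=> a0 sa; rewrite /conj_hyperplane lker_mulmxr.
have [k k0 ->] := hyperplane_form_hyp a0.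
have -> : form_coefs (col_form (k *: a)) = k *: a.
  by apply/colP => i; rewrite mxE col_form_delta.
by rewrite map_mxZ sa hypZ // fmorph_eq0.
Qed.

(** Both t = 1 and t = 2 represent points of the moduli space. *)
Lemma product_not_rigid : ~ rigid (product_arr 1).
Proof.
have n1 : 1 != -1 :> K by rewrite -addr_eq0 (_ : 1 + 1 = 2%:R :> K) ?pnatr_eq0.
have n2 : 2 != -1 :> K by rewrite -addr_eq0 (_ : 2 + 1 = 3%:R :> K) ?pnatr_eq0 // natr1.
have n20 : 2 != 0 :> K by rewrite pnatr_eq0.
have n10 : 1 != 0 :> K := oner_neq0 K.
case=> _ /(_ (product_arr 1) (product_arr 2)).
case=> [||sigma _ [g gU gE]].
- by split; [exact: arrangement_product | exact: product_lattice].
- by split; [exact: arrangement_product | exact: product_lattice].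
have fixed j : map_mx sigma (normal 1 (inr j)) = normal 1 (inr j).
  rewrite /normal map_mxD !map_mxZ !map_delta_mx.
  case: j => [[|[|[|[|//]]]] j4]; rewrite /pencil (tnth_nth (0, 0)) /=;
    by rewrite ?rmorphN ?rmorph0 ?rmorph1.
have img j : exists u, exists2 k : K, k != 0 &
    invmx g *m normal 1 (inr j) = k *: normal 2 u.
  have a0 : invmx g *m normal 1 (inr j) != 0.
    apply: contra_neq (normal_neq0 w 1 (inr j)) => a0.
    by rewrite -(mulKVmx gU (normal 1 (inr j))) a0 mulmx0.
  have : hyp (invmx g *m normal 1 (inr j)) \in product_arr 2.
    rewrite gE; apply/imfsetP; exists (hyp (normal 1 (inr j))); last by rewrite limg_hyp.
    apply/imfsetP; exists (hyp (normal 1 (inr j))); first by apply/product_arrP; exists (inr j).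
    by rewrite conj_hyp // normal_neq0.
  by case/product_arrP => u /(hyp_proportional a0)[k k0 kE]; exists u, k.
(* u j is the index of the image of the j-th line of the harmonic pencil. *)
have [u uE] := fin_all_exists img.
have uinj : injective u.
  move=> j l ujl; have [[k k0 kE] [m m0 mE]] := (uE j, uE l).
  suff : hyp (normal 1 (inr j)) = hyp (normal 1 (inr l)).
    by move=> /(hyp_normal_inj w_root n10 n1) [].
  have -> : normal 1 (inr j) = (k / m) *: normal 1 (inr l).
    rewrite -(mulKVmx gU (normal 1 (inr j))) kE ujl.
    by rewrite -(mulKVmx gU (normal 1 (inr l))) mE -!scalemxAr scalerA divfK.
  by rewrite hypZ // mulf_neq0 ?invr_eq0.
have [[k0 k0n E0] [k1 k1n E1]] := (uE 0, uE 1).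
have [[k2 k2n E2] [k3 k3n E3]] := (uE 2%R, uE 3%R).
apply: (@no_harmonic_quadruple (u 0) (u 1) (u 2%R) (u 3%R) k0 k1 k2 k3) => //.
- by rewrite -[X in uniq X]/(map u [:: 0; 1; 2%R; 3%R]) map_inj_uniq.
- rewrite -E0 -E1 -E2 -mulmxBr; congr (_ *m _).
  rewrite /normal /pencil !(tnth_nth (0, 0)) /=.
  by rewrite !scale0r !scale1r addr0 add0r scaleN1r.
rewrite -E0 -E1 -E3 -mulmxDr; congr (_ *m _).
rewrite /normal /pencil !(tnth_nth (0, 0)) /=.
by rewrite !scale0r !scale1r addr0 add0r.
Qed.

End Moduli.

Lemma product_counterexample (K : numClosedFieldType) :
  exists (r : nat) (A : {fset {vspace 'rV[K]_r}}),
    [/\ arrangement A, free_arrangement A,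
        ~ inductively_free A & ~ rigid A].
Proof.
have [w wE] := @solve_monicpoly K 2 (fun=> -1) isT.
have w_root : w ^+ 2 + w + 1 = 0.
  by rewrite wE !big_ord_recl big_ord0 /= expr0 expr1; ring.
exists (3 + 2)%N, (product_arr w 1); split.
- exact: arrangement_product.
- exact: free_product.
- apply: (product_not_inductively_free w_root (t := 1)) => //.
  + exact: oner_neq0.
  + by rewrite -addr_eq0 (_ : 1 + 1 = 2%:R :> K) ?pnatr_eq0.
  by move=> u; apply/product_arrP; exists (inl u).
exact: product_not_rigid.
Qed.

Theorem corollary1p7 (R : realType) :
  exists (r : nat) (A : {fset {vspace 'rV[R[i]]_r}}),
    [/\ arrangement A, free_arrangement A,
        ~ inductively_free A & ~ rigid A].
Proof.
exact: product_counterexample.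
Qed.
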